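(* Let $\Gamma$ be a pseudogroup generated by (orientation-preserving) local diffeomorphisms of $\mathbb{R}$, acting on $\mathbb{R}\times\mathbb{R}^+$ (coordinates $(x_1,x_2)$) by $\phi: x_1\mapsto\phi(x_1),\ x_2\mapsto \frac{x_2}{\phi'(x_1)}$ for all $\phi\in\Gamma$. Assume that the dimension of the fixed point set of each element $\phi\in\Gamma$ (other than the identity and its restrictions) is strictly less than $2$. Then the connection $$\nabla_{\partial_{x_1}}\partial_{x_1}=\mu(x_1,x_2)\,\partial_{x_2},\quad \nabla_{\partial_{x_1}}\partial_{x_2}=\nabla_{\partial_{x_2}}\partial_{x_1}=\tfrac{1}{2x_2}\partial_{x_1},\quad \nabla_{\partial_{x_2}}\partial_{x_2}=-\tfrac{1}{2x_2}\partial_{x_2},$$ where $\mu$ is a suitable function, is invariant under $\Gamma$ if and only if the action of the Hopf algebra $\mathcal{H}_1$ on the corresponding groupoid algebra $A=\Gamma\ltimes C_c^\infty(\mathbb{R}\times\mathbb{R}^+)$ is projective.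
   Context: Coordinates. $\mathbb{R}\times\mathbb{R}^+$ with coordinates $(x_1,x_2)$ (an open part of the cotangent bundle of $\mathbb{R}$) is identified with the oriented frame bundle of $\mathbb{R}$, with coordinates $(x,y)$, by $x=x_1$, $y=1/x_2$. In the coordinates $(x,y)$ the action of $\phi\in\Gamma$ is $(x,y)\mapsto(\phi(x),\phi'(x)y)$. Groupoid algebra. $A=\Gamma\ltimes C_c^\infty(\mathbb{R}\times\mathbb{R}^+)$ is the crossed product algebra, i.e. the smooth convolution algebra of the étale groupoid of the $\Gamma$-action; it is spanned by elements $fU_\phi$ with $\phi\in\Gamma$ and $f$ a compactly supported smooth function, where $U_\phi$ implements the action of $\phi$ on functions. The Hopf algebra $\mathcal{H}_1$ is, as an algebra, the universal enveloping algebra of the Lie algebra with basis $X,Y,\delta_n$ ($n\ge1$) and brackets $[Y,X]=X$, $[X,\delta_n]=\delta_{n+1}$, $[Y,\delta_n]=n\delta_n$, $[\delta_n,\delta_m]=0$. Its coproduct is determined by $\Delta Y=Y\otimes1+1\otimes Y$, $\Delta\delta_1=\delta_1\otimes1+1\otimes\delta_1$, $\Delta X=X\otimes1+1\otimes X+\delta_1\otimes Y$, and its antipode by $S(Y)=-Y$, $S(\delta_1)=-\delta_1$, $S(X)=-X+\delta_1Y$. It acts on $A$ by $$X(fU_\phi)=(y\partial_xf)U_\phi,\quad Y(fU_\phi)=(y\partial_yf)U_\phi,\quad \delta_n(fU_\phi)=(y\partial_x)^{n-1}(\mu_{\phi^{-1}})\,fU_\phi,\quad \mu_{\phi^{-1}}(x,y)=y\,\frac{(\phi^{-1})''(x)}{(\phi^{-1})'(x)}.$$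 Projective action. An action of $\mathcal{H}_1$ on an algebra $A$ is called projective if $\delta_2'=\delta_2-\tfrac12\delta_1^2$ is inner, implemented by an element $\Omega\in A$, so that $\delta_2'(a)=[\Omega,a]$ for all $a\in A$, and $\delta_k(\Omega)=0$ for all $k\in\mathbb{N}$. A connection is invariant under $\Gamma$ if each local diffeomorphism $(x_1,x_2)\mapsto(\phi(x_1),x_2/\phi'(x_1))$, $\phi\in\Gamma$, preserves it.
   Formalization: In ''projective'', Ω is taken in the multiplier algebra of A (functions on the groupoid mapping A into A on both sides) instead of in A itself, since with compactly supported Ω the equivalence fails. *)

(* Defs.v *)
From HB Require Import structures.
From mathcomp Require Import all_boot all_order all_algebra.
From mathcomp Require Import complex.
From mathcomp Require Import all_classical all_reals all_analysis.

Set Implicit Arguments.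
Unset Strict Implicit.
Unset Printing Implicit Defensive.

Import Order.TTheory GRing.Theory Num.Theory.
Import numFieldNormedType.Exports.

Local Open Scope classical_set_scope.
Local Open Scope ring_scope.
Local Open Scope complex_scope.

Fixpoint Ck (R : realType) (V W : normedModType R) (n : nat) (U : set V)
    (f : V -> W) : Prop :=
  match n with
  | 0 => forall p, U p -> {for p, continuous f}
  | n'.+1 => (forall p, U p -> differentiable f p) /\
             (forall v : V, Ck n' U ('D_v f))
  end.

(* Only meant for open U; the values of f outside U are irrelevant. *)
Definition smooth (R : realType) (V W : normedModType R) (U : set V)
  (f : V -> W) : Prop := forall n, Ck n U f.

(* Open sets of the subspace X are represented by open sets of the ambient
   space T, and only their traces on X matter. *)
Definition covdim_le (T : topologicalType) (X : set T) (n : nat) : Prop :=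
  forall (I : finType) (U : I -> set T),
    (forall i, open (U i)) -> X `<=` \bigcup_i U i ->
    exists (J : finType) (V : J -> set T),
      [/\ forall j, open (V j),
          X `<=` \bigcup_j V j,
          forall j, exists i, V j `&` X `<=` U i
        & forall p, X p -> (#|[pred j | `[< V j p >]]| <= n.+1)%N].

Section Setting.
Variable R : realType.

Local Notation plane := (R * R)%type.

(* R x R^+; used both for the coordinates (x_1, x_2) and for the coordinates
   (x, y) = (x_1, 1 / x_2). *)
Definition half_plane : set plane := [set p | 0 < p.2].

(* A partial map together with a partial inverse; pfwd is relevant on pdom
   only and pbwd on pfwd @` pdom only. *)
Record partial_map := PartialMap {
  pdom : set R;
  pfwd : R -> R;
  pbwd : R -> R }.

HB.instance Definition _ := gen_eqMixin partial_map.
HB.instance Definition _ := gen_choiceMixin partial_map.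

Definition prange (phi : partial_map) : set R := pfwd phi @` pdom phi.

Definition pidentity : partial_map := PartialMap setT id id.

Definition pcompose (phi psi : partial_map) : partial_map :=
  PartialMap (pdom psi `&` pfwd psi @^-1` pdom phi)
    (pfwd phi \o pfwd psi) (pbwd psi \o pbwd phi).

Definition pinverse (phi : partial_map) : partial_map :=
  PartialMap (prange phi) (pbwd phi) (pfwd phi).

Definition prestrict (U : set R) (phi : partial_map) : partial_map :=
  PartialMap (pdom phi `&` U) (pfwd phi) (pbwd phi).

Definition local_diffeo (phi : partial_map) : Prop :=
  [/\ open (pdom phi) /\ open (prange phi),
      forall x, pdom phi x -> pbwd phi (pfwd phi x) = x,
      smooth (pdom phi) (pfwd phi : R -> R),
      smooth (prange phi) (pbwd phi : R -> R)
    & forall x, pdom phi x -> 0 < derive1 (pfwd phi) x].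

(* No gluing axiom: gluing a nontrivial element to an identity map defined on
   a disjoint interval yields an element whose fixed points have nonempty
   interior. *)
Record pseudogroup (Gamma : set partial_map) : Prop := {
  pseudogroup_diffeo : forall phi, Gamma phi -> local_diffeo phi;
  pseudogroup_id : Gamma pidentity;
  pseudogroup_comp : forall phi psi, Gamma phi -> Gamma psi ->
    Gamma (pcompose phi psi);
  pseudogroup_inv : forall phi, Gamma phi -> Gamma (pinverse phi);
  pseudogroup_restr : forall phi (U : set R), Gamma phi -> open U ->
    Gamma (prestrict U phi) }.

Definition lift_dom (phi : partial_map) : set plane :=
  [set p | pdom phi p.1 /\ half_plane p].

(* The action in the coordinates (x_1, x_2). *)
Definition act_cotangent (phi : partial_map) (p : plane) : plane :=
  (pfwd phi p.1, p.2 / derive1 (pfwd phi) p.1).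

(* The action in the coordinates (x, y). *)
Definition act_frame (phi : partial_map) (p : plane) : plane :=
  (pfwd phi p.1, derive1 (pfwd phi) p.1 * p.2).

Definition fixed_points (phi : partial_map) : set plane :=
  [set p | lift_dom phi p /\ act_cotangent phi p = p].

Definition restriction_of_id (phi : partial_map) : Prop :=
  forall x, pdom phi x -> pfwd phi x = x.

Definition vector_field := plane -> plane.

Definition connection := vector_field -> vector_field -> vector_field.

Definition d1 : plane := (1, 0).
Definition d2 : plane := (0, 1).

Definition nabla (mu : plane -> R) : connection := fun X Y p =>
  'D_(X p) Y p
  + ((X p).1 * (Y p).1 * mu p) *: d2
  + (((X p).1 * (Y p).2 + (X p).2 * (Y p).1) / (2 * p.2)) *: d1
  - ((X p).2 * (Y p).2 / (2 * p.2)) *: d2.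

Definition related (U : set plane) (F : plane -> plane)
    (X X' : vector_field) : Prop :=
  forall p, U p -> 'D_(X p) F p = X' (F p).

(* F is meant to be a diffeomorphism from the open set U onto its image. *)
Definition preserves (U : set plane) (F : plane -> plane)
    (D : connection) : Prop :=
  forall X Y X' Y' : vector_field,
    smooth U X -> smooth U Y -> smooth (F @` U) X' -> smooth (F @` U) Y' ->
    related U F X X' -> related U F Y Y' -> related U F (D X Y) (D X' Y').

Definition invariant_connection (Gamma : set partial_map)
    (D : connection) : Prop :=
  forall phi, Gamma phi -> preserves (lift_dom phi) (act_cotangent phi) D.

(* The germ at x of a local diffeomorphism phi, as an equivalence class. *)
Definition germ (phi : partial_map) (x : R) : set partial_map :=
  [set psi | [/\ local_diffeo psi, pdom psi x
              & \forall t \near x, pfwd psi t = pfwd phi t]].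

(* An arrow is a source together with a germ at its base point. *)
Definition arrow := (plane * set partial_map)%type.

Definition mk_arrow (phi : partial_map) (p : plane) : arrow :=
  (p, germ phi p.1).

Definition groupoid (Gamma : set partial_map) : set arrow :=
  [set c | exists phi p, [/\ Gamma phi, lift_dom phi p & c = mk_arrow phi p]].

Definition arrow_rep (c : arrow) : partial_map := xget pidentity c.2.

Definition arrow_target (c : arrow) : plane := act_frame (arrow_rep c) c.1.

Definition factorizations (Gamma : set partial_map) (c : arrow) :
    set (arrow * arrow) :=
  [set q | exists phi psi p,
    [/\ Gamma phi /\ Gamma psi,
        lift_dom psi p /\ lift_dom phi (act_frame psi p),
        q = (mk_arrow phi (act_frame psi p), mk_arrow psi p)
      & c = mk_arrow (pcompose phi psi) p]].

Definition gfun := arrow -> R[i].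

(* If a belongs to the algebra, at most finitely many terms of the sums
   defining convol Gamma a b and convol Gamma b a are nonzero, whatever b. *)
Definition convol (Gamma : set partial_map) (a b : gfun) : gfun :=
  fun c => \sum_(q \in factorizations Gamma c) a q.1 * b q.2.

Definition csmooth (U : set plane) (f : plane -> R[i]) : Prop :=
  smooth U ((fun p => complex.Re (f p)) : plane -> R) /\
  smooth U ((fun p => complex.Im (f p)) : plane -> R).

Definition cderive (v : plane) (f : plane -> R[i]) (p : plane) : R[i] :=
  'D_v ((fun q => complex.Re (f q)) : plane -> R) p
  +i* 'D_v ((fun q => complex.Im (f q)) : plane -> R) p.

Definition test_function (U : set plane) (f : plane -> R[i]) : Prop :=
  [/\ csmooth half_plane f, compact (closure [set p | f p != 0])
    & closure [set p | f p != 0] `<=` U].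

(* The element f U_phi; its value at the arrow of phi with target q is f q,
   so that (f U_phi)(g U_psi) = f (g o phi^-1) U_(phi psi). *)
Definition fU (f : plane -> R[i]) (phi : partial_map) : gfun :=
  fun c => if `[< lift_dom phi c.1 /\ c = mk_arrow phi c.1 >]
           then f (act_frame phi c.1) else 0.

Definition galgebra (Gamma : set partial_map) : set gfun :=
  [set a | exists n (f : 'I_n -> plane -> R[i]) (phi : 'I_n -> partial_map),
    (forall i, Gamma (phi i) /\
       test_function (act_frame (phi i) @` lift_dom (phi i)) (f i)) /\
    a = fun c => \sum_(i < n) fU (f i) (phi i) c].

(* The algebra has no unit; its multipliers are realised as functions on the
   groupoid and contain the algebra itself. *)
Definition multiplier (Gamma : set partial_map) : set gfun :=
  [set Omega | (forall c, ~ groupoid Gamma c -> Omega c = 0) /\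
    forall a, galgebra Gamma a ->
      galgebra Gamma (convol Gamma Omega a) /\
      galgebra Gamma (convol Gamma a Omega)].

(* Hdelta n stands for delta_n and is meaningful for n >= 1 only. *)
Inductive H1_generator := HX | HY | Hdelta of nat.

(* The function f such that a = f U_phi on the arrows of phi. *)
Definition coef (a : gfun) (phi : partial_map) (q : plane) : R[i] :=
  a (mk_arrow phi (act_frame (pinverse phi) q)).

Definition mu_inv (phi : partial_map) (q : plane) : R :=
  q.2 * (derive1 (derive1 (pbwd phi)) q.1 / derive1 (pbwd phi) q.1).

Definition y_dx (f : plane -> R) (q : plane) : R := q.2 * 'D_d1 f q.

Definition H1_action (Gamma : set partial_map) (h : H1_generator)
    (a : gfun) : gfun :=
  fun c => if `[< groupoid Gamma c >] then
    let phi := arrow_rep c in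
    let q := arrow_target c in
    match h with
    | HX => q.2%:C * cderive d1 (coef a phi) q
    | HY => q.2%:C * cderive d2 (coef a phi) q
    | Hdelta n => (iter n.-1 y_dx (mu_inv phi) q)%:C * a c
    end
  else 0.

Definition delta2' (act : H1_generator -> gfun -> gfun) (a : gfun) : gfun :=
  fun c => act (Hdelta 2) a c
           - 2^-1 * act (Hdelta 1) (act (Hdelta 1) a) c.

Definition projective (Gamma : set partial_map)
    (act : H1_generator -> gfun -> gfun) : Prop :=
  exists Omega : gfun,
    [/\ multiplier Gamma Omega,
        forall a, galgebra Gamma a -> forall c,
          delta2' act a c = convol Gamma Omega a c - convol Gamma a Omega c
      & forall k, (0 < k)%N -> forall c, act (Hdelta k) Omega c = 0].

End Setting.

(* Main.v *)
(* An invariant connection amounts to a function w on the frame bundle with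
   w(phi q) - w(q) = y^2 S(phi)(x) for all phi, where S is the Schwarzian
   derivative: among the Christoffel symbols only the coefficient mu of
   nabla_(d1) d1 is not preserved automatically, and w(x, y) = y^3 mu(x, 1/y).
   On the other hand delta_2' multiplies f U_phi by y^2 S(phi^-1).  Hence -w,
   supported on the unit arrows, implements delta_2'.  Conversely, an
   implementing multiplier Omega is supported on isotropy arrows, since it
   commutes with the functions, and the sum of Omega over all arrows with source
   p is a smooth function of p; conjugating isotropy groups by phi shows that
   minus its real part is the required w.  The summation over isotropy makes
   the argument independent of the groupoid being Hausdorff. *)
Require Import Defs.
From mathcomp Require Import all_boot all_order all_algebra.
From mathcomp Require Import complex ring lra.
From mathcomp Require Import all_classical all_reals all_analysis.

Set Implicit Arguments.
Unset Strict Implicit.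
Unset Printing Implicit Defensive.

Import Order.TTheory GRing.Theory Num.Theory.
Import numFieldNormedType.Exports.

Local Open Scope classical_set_scope.
Local Open Scope ring_scope.
Local Open Scope complex_scope.

(** * Functions of class C^k *)

Section Ck_calculus.
Variable R : realType.
Implicit Types V W : normedModType R.

(** Why conjugation changes Omega at units only: let chi be an isotropy arrow at p, q = phi(p) and
    psi = phi chi phi^-1, and evaluate the commutator of Omega with f U_phi at the arrow phi chi =
    psi phi. Each convolution reduces to one product, so the commutator is (Omega(psi) - Omega(chi))
    f(q). On the other side, delta_2'(f U_phi) vanishes at this arrow unless chi has the germ of the
    identity, because f U_phi lives on arrows of phi; at the unit it is y^2 S(phi^-1) f(q). As
    conjugation is a bijection of isotropy groups, the sum of Omega picks up this real function
    exactly once.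

    The other difficulty is regularity: a multiplier is known only through its products. Multiplying
    Omega on the right by a bump function g on the units lands in the algebra, so g(source) Omega is
    a finite sum of terms f_i U_phi_i. This gives both the finite support of Omega over each source
    and, after division by g, the local smoothness of its sum. *)

Lemma near_eq_differentiable V W (f g : V -> W) (x : V) :
  (\near x, f x = g x) -> differentiable f x -> differentiable g x.
Proof.
move=> fg df.
have [dfc fE] : continuous ('d f x) /\ g \o shift x = cst (g x) + 'd f x +o_ 0 id.
  split; first exact: diff_continuous.
  have /eqaddoP fE := diff_locally df.
  apply/eqaddoP => e e0; have {}fE := fE e e0.
  have fgx : \forall h \near (0 : V), f (h + x) = g (h + x).
    have := fg; rewrite (near_shift 0) /= subr0.
    exact: filterS.
  have fgx0 := nbhs_singleton fg.
  near=> h.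
  have -> : (g \o shift x - (cst (g x) + 'd f x)) h
          = (f \o shift x - (cst (f x) + 'd f x)) h.
    rewrite /= -[LHS]/(g (h + x) - (g x + 'd f x h)).
    rewrite -[RHS]/(f (h + x) - (f x + 'd f x h)) fgx0; congr (_ - _).
    by apply/esym; near: h.
  by near: h.
by apply/diff_locallyP; rewrite (diff_unique dfc fE).
Unshelve. all: by end_near. Qed.

Lemma CkW V W n (U : set V) (f : V -> W) : Ck n.+1 U f -> Ck n U f.
Proof.
elim: n f => [|n IH] f [fd fC].
  by move=> p Up; exact: differentiable_continuous (fd p Up).
by split=> // v; apply: IH.
Qed.

(** Derivatives are taken in the whole space, so [Ck] is a condition at each point of [U]
    separately, and any set containing the point can serve as [N]. *)
Lemma Ck_local V W n (U : set V) (f : V -> W) :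
  (forall p, U p -> exists N : set V, N p /\ Ck n N f) -> Ck n U f.
Proof.
elim: n f => [|n IH] f H.
  by move=> p /H[N [Np]]; apply.
split=> [p /H[N [Np [fd _]]]|v]; first exact: fd.
by apply: IH => p /H[N [Np [_ fC]]]; exists N; split=> //; exact: fC.
Qed.

Lemma sub_Ck V W n (A B : set V) (f : V -> W) : A `<=` B -> Ck n B f -> Ck n A f.
Proof. by move=> AB fB; apply: Ck_local => p /AB Bp; exists B. Qed.

(** Openness of [U] turns equality on [U] into equality near each of its points, which is what
    derivatives see. *)
Lemma eq_Ck V W n (U : set V) (f g : V -> W) : open U ->
  {in U, f =1 g} -> Ck n U f -> Ck n U g.
Proof.
move=> oU; elim: n f g => [|n IH] f g fg.
  move=> fC p Up; have := fC p Up.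
  have nfg : \forall q \near p, f q = g q.
    by apply: filterS (open_nbhs_nbhs (conj oU Up)) => q Uq; apply: fg; rewrite inE.
  rewrite /prop_for /continuous_at (nbhs_singleton nfg).
  by apply: cvg_trans; apply: near_eq_cvg; apply: filterS nfg.
have nfg p : U p -> \forall q \near p, f q = g q.
  move=> Up; apply: filterS (open_nbhs_nbhs (conj oU Up)) => q Uq.
  by apply: fg; rewrite inE.
move=> [fd fC]; split=> [p Up|v].
  exact: near_eq_differentiable (nfg p Up) (fd p Up).
apply: IH (fC v) => p; rewrite inE => Up.
exact: near_eq_derive (nfg p Up).
Qed.

Lemma Ck_cst V W n (U : set V) (c : W) : Ck n U (cst c).
Proof.
elim: n c => [|n IH] c; first by move=> p _; exact: cst_continuous.
split=> [p _|v]; first exact: differentiable_cst.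
rewrite (_ : 'D_v _ = cst 0) //.
by apply/funext => p; rewrite derive_cst.
Qed.

Lemma Ck_linear V W n (U : set V) (f : {linear V -> W}) :
  continuous f -> Ck n U f.
Proof.
move=> fc; case: n => [p _|n]; first exact: fc.
split=> [p _|v]; first exact: linear_differentiable.
rewrite (_ : 'D_v _ = cst (f v)); first exact: Ck_cst.
apply/funext => p; rewrite deriveE; last exact: linear_differentiable.
by rewrite diff_lin.
Qed.

Lemma CkD V W n (U : set V) (f g : V -> W) : open U ->
  Ck n U f -> Ck n U g -> Ck n U (f \+ g).
Proof.
move=> oU; elim: n f g => [|n IH] f g fC gC.
  by move=> p Up; apply: continuousD; [exact: fC|exact: gC].
have [[fd fC'] [gd gC']] := (fC, gC).
split=> [p Up|v]; first by apply: differentiableD; [exact: (fd p Up)|exact: (gd p Up)].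
apply: (@eq_Ck _ _ _ _ ('D_v f \+ 'D_v g)) => //; last exact: IH (fC' v) (gC' v).
move=> p; rewrite inE => Up; rewrite deriveD//; apply: diff_derivable.
  exact: (fd p Up).
exact: (gd p Up).
Qed.

Lemma CkM V n (U : set V) (f g : V -> R) : open U ->
  Ck n U f -> Ck n U g -> Ck n U (f \* g).
Proof.
move=> oU; elim: n f g => [|n IH] f g fC gC.
  by move=> p Up; apply: continuousM; [exact: fC|exact: gC].
have [[fd fC'] [gd gC']] := (fC, gC).
split=> [p Up|v]; first by apply: differentiableM; [exact: (fd p Up)|exact: (gd p Up)].
apply: (@eq_Ck _ _ _ _ ((f \* 'D_v g) \+ (g \* 'D_v f))) => //; last first.
  apply: CkD => //.
    by apply: IH; [exact: CkW|exact: gC'].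
  by apply: IH; [exact: CkW|exact: fC'].
move=> p; rewrite inE => Up; rewrite [RHS]deriveM//; apply: diff_derivable.
  exact: (fd p Up).
exact: (gd p Up).
Qed.

Lemma CkV V n (U : set V) (f : V -> R) : open U ->
  (forall p, U p -> f p != 0) -> Ck n U f -> Ck n U (fun p => (f p)^-1).
Proof.
move=> oU f0; elim: n => [|n IH] fC.
  by move=> p Up; apply: cvgV; [exact: f0|exact: fC].
have [fd fC'] := fC.
split=> [p Up|v]; first by apply: differentiableV; [exact: (fd p Up)|exact: f0].
have IHC := IH (CkW fC).
apply: (@eq_Ck _ _ _ _ (cst (-1) \* ((fun p => (f p)^-1) \* (fun p => (f p)^-1))
   \* 'D_v f)) => //; last first.
  by apply: CkM => //; last exact: fC'; do !apply: CkM => //; exact: Ck_cst.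
move=> p; rewrite inE => Up; rewrite deriveE; last first.
  by apply: differentiableV; [exact: (fd p Up)|exact: f0].
rewrite diffV; [|exact: (fd p Up)|exact: f0] => /=.
by rewrite -deriveE /= ?mulN1r -?invfM //; exact: (fd p Up).
Qed.

Lemma Ck_pair V W1 W2 n (U : set V) (f : V -> W1) (g : V -> W2) : open U ->
  Ck n U f -> Ck n U g -> Ck n U (fun p => (f p, g p)).
Proof.
move=> oU; elim: n f g => [|n IH] f g fC gC.
  by move=> p Up; apply: cvg_pair; [exact: fC|exact: gC].
have [[fd fC'] [gd gC']] := (fC, gC).
split=> [p Up|v]; first exact: differentiable_pair (fd p Up) (gd p Up).
apply: (@eq_Ck _ _ _ _ (fun p => ('D_v f p, 'D_v g p))) => //; last first.
  exact: IH (fC' v) (gC' v).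
move=> p; rewrite inE => Up.
have [fdp gdp] := (fd p Up, gd p Up).
by rewrite !deriveE ?diff_pair//; exact: differentiable_pair.
Qed.

Lemma Ck_comp1 V n (D : set R) (U : set V) (g : R -> R) (f : V -> R) :
   open U -> (forall p, U p -> D (f p)) ->
   Ck n D g -> Ck n U f -> Ck n U (fun p => g (f p)).
Proof.
move=> oU fU; elim: n g => [|n IH] g gC fC.
  by move=> p Up; apply: continuous_comp; [exact: fC|apply/gC/fU].
have [[fd fC'] [gd gC']] := (fC, gC).
split=> [p Up|v].
  by apply: (@differentiable_comp _ _ _ _ f g); [exact: (fd p Up)|apply/gd/fU].
apply: (@eq_Ck _ _ _ _ ('D_v f \* (fun p => 'D_1 g (f p)))) => //; last first.
  by apply: CkM => //; [exact: fC'|apply: (IH ('D_1 g)); [exact: gC'|exact: CkW]].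
move=> p; rewrite inE => Up; have [fdp gdp] := (fd p Up, gd _ (fU p Up)).
rewrite /= [RHS]deriveE; last exact: (@differentiable_comp _ _ _ _ f g).
by rewrite (diff_comp fdp gdp) /= diff1E // -derive1E -deriveE.
Qed.

Lemma pair_basis (a b : R) : (a, b) = a *: (1, 0) + b *: (0, 1) :> R * R.
Proof.
by apply/pair_equal_spec; split=> /=; rewrite scaler0 ?addr0 ?add0r; exact/esym/mulr1.
Qed.

Lemma derive_comp2 V (g : R * R -> R) (f1 f2 : V -> R) v p :
  differentiable f1 p -> differentiable f2 p ->
  differentiable g (f1 p, f2 p) ->
  'D_v (fun p => g (f1 p, f2 p)) p =
  'D_v f1 p * 'D_(1, 0) g (f1 p, f2 p) + 'D_v f2 p * 'D_(0, 1) g (f1 p, f2 p).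
Proof.
move=> f1d f2d gd; have fd := differentiable_pair f1d f2d.
rewrite [LHS]deriveE; last first.
  exact: (@differentiable_comp _ _ _ _ (fun p => (f1 p, f2 p)) g).
rewrite (diff_comp fd gd) /= diff_pair //= -!deriveE //.
rewrite [X in 'D_X g _](_ : _ = 'D_v f1 p *: (1, 0) + 'D_v f2 p *: (0, 1)).
  by rewrite !deriveE // linearD !linearZ.
exact: pair_basis.
Qed.

(** The chain rule is expanded along the fixed directions (1, 0) and (0, 1). [Ck] speaks of constant
    directions only, so a derivative of [g] in a direction varying with the point would not fit the
    induction. *)
Lemma Ck_comp2 V n (D : set (R * R)) (U : set V) (g : R * R -> R) (f1 f2 : V -> R) :
   open U -> (forall p, U p -> D (f1 p, f2 p)) ->
   Ck n D g -> Ck n U f1 -> Ck n U f2 -> Ck n U (fun p => g (f1 p, f2 p)).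
Proof.
move=> oU fU; elim: n g => [|n IH] g gC f1C f2C.
  move=> p Up; apply: (@continuous_comp _ _ _ (fun p => (f1 p, f2 p)) g).
    exact: (@Ck_pair V R R 0 U f1 f2 oU f1C f2C p Up).
  by apply/gC/fU.
have [[f1d f1C'] [f2d f2C'] [gd gC']] := And3 f1C f2C gC.
split=> [p Up|v].
  apply: (@differentiable_comp _ _ _ _ (fun p => (f1 p, f2 p)) g).
    by apply: differentiable_pair; [exact: (f1d p Up)|exact: (f2d p Up)].
  exact/gd/fU.
apply: (@eq_Ck _ _ _ _ (('D_v f1 \* (fun p => 'D_(1, 0) g (f1 p, f2 p)))
  \+ ('D_v f2 \* (fun p => 'D_(0, 1) g (f1 p, f2 p))))) => //; last first.
  apply: CkD => //; apply: CkM => //; [exact: f1C'| |exact: f2C'|].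
    by apply: (IH ('D_(1, 0) g)); [exact: gC'|exact: CkW|exact: CkW].
  by apply: (IH ('D_(0, 1) g)); [exact: gC'|exact: CkW|exact: CkW].
move=> p; rewrite inE => Up.
by rewrite /= derive_comp2//; [exact: (f1d p Up)|exact: (f2d p Up)|apply/gd/fU].
Qed.

Lemma Ck_fst V W n (U : set (V * W)) : Ck n U (fst : V * W -> V).
Proof. by apply: (@Ck_linear _ _ _ _ fst) => x; exact: cvg_fst. Qed.

Lemma Ck_snd V W n (U : set (V * W)) : Ck n U (snd : V * W -> W).
Proof. by apply: (@Ck_linear _ _ _ _ snd) => x; exact: cvg_snd. Qed.

End Ck_calculus.

(** * Bump functions *)

Section Bump.
Variable R : realType.

(* This family of functions is closed under differentiation. *)
Definition flat (P : {poly R}) (x : R) : R :=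
  if 0 < x then P.[x^-1] * expR (- x^-1) else 0.

(** The exponential beats every power of 1/x. A linear rate suffices, since the differentiability of
    [flat P] at 0 is read off from this bound for ['X * P]. *)
Lemma flat_le P : exists2 C : R, 0 <= C & forall x, `|flat P x| <= C * `|x|.
Proof.
pose C := \sum_(i < size P) `|P`_i| * (i.+1)`!%:R.
have C0 : 0 <= C by apply: sumr_ge0 => i _; exact: mulr_ge0.
exists C => // x; rewrite /flat; case: ifPn => x0; last by rewrite normr0 mulr_ge0.
rewrite horner_coef mulr_suml /C mulr_suml.
apply: le_trans (ler_norm_sum _ _ _) _; apply: ler_sum => i _.
rewrite normrM normrM -!mulrA; apply: ler_wpM2l => //.
have t0 : 0 < x^-1 by rewrite invr_gt0.
rewrite !gtr0_norm ?exprn_gt0 ?expR_gt0 // expRN ler_pdivrMr ?expR_gt0 //.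
(* With t = 1/x, expR t is at least t^(i+1) / (i+1)!: one power more than the monomial at hand,
   which leaves the factor x. *)
have := expR_ge1Dxn i (ltW t0); set E := expR _ => HE.
have f0 : (0 : R) < (i.+1)`!%:R by rewrite ltr0n fact_gt0.
have {}HE : x^-1 ^+ i.+1 / (i.+1)`!%:R <= E by apply: le_trans HE; rewrite lerDr.
rewrite ler_pdivrMr // exprS in HE.
rewrite -(ler_pM2l t0); apply: le_trans HE _.
by rewrite le_eqVlt; apply/orP; left; apply/eqP; field; rewrite gt_eqF.
Qed.

Lemma flat_mulX P x : flat ('X * P) x = x^-1 * flat P x.
Proof.
by rewrite /flat; case: ifP; rewrite ?mulr0 // hornerM hornerX mulrA.
Qed.

(** For x > 0 the derivative of P(1/x) is -x^-2 P'(1/x) and that of exp(-1/x) is x^-2 exp(-1/x),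
    whence the polynomial X^2 (P - P'). *)
Lemma is_derive_flat P (x : R) :
  is_derive x 1 (flat P) (flat ('X^2 * (P - P^`())) x).
Proof.
have [x0|x0|->] := ltgtP x 0.
- rewrite {2}/flat ltNge (ltW x0) /=.
  have H : \near x, cst 0 x = flat P x.
    by have := lt_nbhsl x0; apply: filterS => y y0; rewrite /flat ltNge (ltW y0).
  exact: near_eq_is_derive H (is_derive_cst _ _ _).
- rewrite {2}/flat x0.
  have H : \near x, (fun x : R => P.[x^-1] * expR (- x^-1)) x = flat P x.
    by have := lt_nbhsr x0; apply: filterS => y y0; rewrite /flat y0.
  apply: near_eq_is_derive H _.
  have xn0 : x != 0 by rewrite gt_eqF.
  have dV : is_derive x 1 (fun y : R => y^-1) (- x ^- 2).
    apply: is_derive_eq; first by apply: is_deriveV.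
    exact: mulr1.
  have dP := is_derive1_comp (is_derive_poly P x^-1) dV.
  have dN : is_derive x 1 (fun y : R => - y^-1) (x ^- 2).
    by apply: is_derive_eq; rewrite opprK.
  have dE := @is_derive1_comp _ expR (fun y : R => - y^-1) x _ _ (is_derive_expR _) dN.
  have dM := is_deriveM dP dE.
  refine (@is_derive_eq _ _ _ _ _ _ _ _ dM _).
  rewrite /= hornerM hornerXn hornerD hornerN exprVn.
  rewrite -![_ *: _]/(_ * _); ring.
- rewrite {2}/flat ltxx.
  suff H : (fun h : R => h^-1 *: (flat P (h *: 1 + 0) - flat P 0)) @ 0^' --> (0 : R).
    apply: DeriveDef; first by apply/cvg_ex; exists 0.
    exact: cvg_lim H.
  (* Division by h multiplies the polynomial by X, so the difference quotient at 0 is again a flat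
     function, and [flat_le] makes it tend to 0. *)
  have -> : (fun h : R => h^-1 *: (flat P (h *: 1 + 0) - flat P 0)) = flat ('X * P).
    apply/funext => h; rewrite flat_mulX {2}/flat ltxx subr0 addr0.
    by rewrite [h *: 1]mulr1.
  have [C _ HC] := flat_le ('X * P).
  by apply: (@cvg_to_0_linear _ _ C 1) => // r _; exact: HC.
Qed.

Lemma smooth_flat P : smooth setT (flat P).
Proof.
move=> n; elim: n P => [|n IH] P.
  move=> p _; apply: differentiable_continuous; apply/derivable1_diffP.
  by have [] := is_derive_flat P p.
have fd p : differentiable (flat P) p.
  by apply/derivable1_diffP; have [] := is_derive_flat P p.
split=> [p _|v]; first exact: fd.
rewrite (_ : 'D_v _ = (cst v) \* flat ('X^2 * (P - P^`()))).
  by apply: CkM; [exact: openT|exact: Ck_cst|exact: IH].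
apply/funext => p; rewrite deriveE // diff1E // derive1E.
by have [_ ->] := is_derive_flat P p.
Qed.

Local Notation plane := (R * R)%type.

Lemma exists_bump (U : set plane) (p : plane) : nbhs p U ->
  exists g : plane -> R, [/\ smooth setT g, g p != 0,
    compact (closure [set q | g q != 0]) & closure [set q | g q != 0] `<=` U].
Proof.
move=> /nbhs_ballP[e /= e0 eU].
pose r := e / 2.
have r0 : 0 < r by exact: divr_gt0.
(* This is exp(-1 / (r^2 - (x - a)^2)) for |x - a| < r and 0 elsewhere. Balls of the plane are
   squares, so a product of two such functions fits; r = e / 2 keeps the closed square inside the
   open ball. *)
pose h (a x : R) := flat 1 (r ^+ 2 - (x - a) * (x - a)).
have h_neq0 a x : (h a x != 0) = (`|x - a| < r).
  rewrite /h /flat subr_gt0 -expr2 -[X in X < _]real_normK ?num_real //.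
  rewrite ltr_pXn2r ?nnegrE // ?ltW //.
  by case: ifP; rewrite ?eqxx // hornerC mul1r gt_eqF // expR_gt0.
pose g (q : plane) := h p.1 q.1 * h p.2 q.2.
pose K := (`[p.1 - r, p.1 + r] `*` `[p.2 - r, p.2 + r])%classic : set plane.
have Kc : compact K by apply: compact_setX; exact: segment_compact.
have gK : closure [set q | g q != 0] `<=` K.
  rewrite closureE => q; apply; split.
    by apply: compact_closed Kc; exact: norm_hausdorff.
  move=> z /=; rewrite mulf_eq0 negb_or !h_neq0 => /andP[z1 z2].
  by split; rewrite /= in_itv /= -ler_distlC distrC ltW.
exists g; split.
- move=> n; rewrite /g.
  have hC (a : R) (f : plane -> R) : Ck n setT f -> Ck n setT (fun q => h a (f q)).
    move=> fC; apply: (@Ck_comp1 _ _ _ setT setT (flat 1)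
      (fun q => r ^+ 2 - (f q - a) * (f q - a))) => //.
    - exact: openT.
    - exact: smooth_flat.
    - have fa : Ck n setT (fun q => f q + - a).
        by apply: CkD => //; [exact: openT|exact: Ck_cst].
      apply: (@eq_Ck _ _ _ _ _ (cst (r ^+ 2) \+
        (cst (-1) \* ((fun q => f q + - a) \* (fun q => f q + - a))))).
      + exact: openT.
      + by move=> q _ /=; rewrite mulN1r.
      + apply: CkD; [exact: openT|exact: Ck_cst|].
        apply: CkM; [exact: openT|exact: Ck_cst|].
        by apply: CkM; [exact: openT| |].
  apply: CkM; [exact: openT| |]; apply: hC; [exact: Ck_fst|exact: Ck_snd].
- by rewrite mulf_neq0 // h_neq0 subrr normr0.
- apply: subclosed_compact Kc gK; exact: closed_closure.
- apply: subset_trans gK _ => q [/= q1 q2]; apply: eU.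
  have re : r < e by rewrite /r; lra.
  have near_ball (a x : R) : x \in `[a - r, a + r] -> ball a e x.
    rewrite in_itv /= => ax; rewrite -ball_normE /=.
    by apply: le_lt_trans re; rewrite ler_distlC.
  by split; exact: near_ball.
Qed.

End Bump.

(** * Invariance of the connection *)

Section Connection.
Variable R : realType.
Local Notation plane := (R * R)%type.
Local Notation half_plane := (@half_plane R).

(** Kept as (f''/f')' - (f''/f')^2 / 2, the shape in which delta_2 - delta_1^2 / 2 produces it;
    [schwarzianE] gives the expanded form used for the connection. *)
Definition schwarzian (f : R -> R) (x : R) : R :=
  derive1 (fun t => derive1 (derive1 f) t / derive1 f t) x
  - 2^-1 * (derive1 (derive1 f) x / derive1 f x) ^+ 2.

Lemma smooth_derive1 (D : set R) (f : R -> R) : smooth D f -> smooth D (derive1 f).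
Proof.
move=> fC n; have [_ /(_ 1)] := fC n.+1.
by rewrite (_ : 'D_1 f = derive1 f) //; apply/funext => x; rewrite derive1E.
Qed.

Lemma smooth_differentiable (V W : normedModType R) (U : set V) (f : V -> W) p :
  smooth U f -> U p -> differentiable f p.
Proof. by move=> fC Up; have [fd _] := fC 1%N; exact: fd. Qed.

Lemma smooth_derivable1 (D : set R) (f : R -> R) x :
  smooth D f -> D x -> is_derive x 1 f (derive1 f x).
Proof.
move=> fC Dx; rewrite derive1E; apply: derivableP.
by apply/derivable1_diffP; exact: smooth_differentiable fC Dx.
Qed.

Lemma schwarzianE (D : set R) (f : R -> R) x : smooth D f -> D x ->
  derive1 f x != 0 ->
  schwarzian f x = derive1 (derive1 (derive1 f)) x / derive1 f x
                   - 3 / 2 * (derive1 (derive1 f) x / derive1 f x) ^+ 2.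
Proof.
move=> fC Dx f0; have f1C := smooth_derive1 fC; have f2C := smooth_derive1 f1C.
have f1d := smooth_derivable1 f1C Dx; have f2d := smooth_derivable1 f2C Dx.
have [_ E] := is_deriveM f2d (is_deriveV f0 f1d).
rewrite /schwarzian derive1E.
rewrite (E : 'D_1 (fun t => derive1 (derive1 f) t / derive1 f t) x = _).
have alg (a b c : R) : a != 0 ->
    b * (- a ^- 2 * b) + a^-1 * c - 2^-1 * (b / a) ^+ 2 =
    c / a - 3 / 2 * (b / a) ^+ 2 by move=> a0; field.
exact: alg.
Qed.

Lemma open_half_plane : open half_plane.
Proof.
have -> : half_plane = (snd : plane -> R) @^-1` `]0, +oo[%classic.
  by apply/seteqP; split=> p /=; rewrite in_itv /= andbT.
by apply: open_comp; [move=> p _; exact: cvg_snd|exact: interval_open].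
Qed.

Lemma open_lift_dom (phi : partial_map R) : open (pdom phi) -> open (lift_dom phi).
Proof.
move=> oD.
have -> : lift_dom phi = (fst : plane -> R) @^-1` pdom phi `&` half_plane by [].
apply: openI open_half_plane.
by apply: open_comp => // p _; exact: cvg_fst.
Qed.

Lemma is_derive_fst (h : R -> R) (h' : R) (p v : plane) :
  is_derive p.1 1 h h' -> is_derive p v (fun q => h q.1) (v.1 * h').
Proof.
move=> [/derivable1_diffP hd <-].
have fd : differentiable (fst : plane -> R) p := (@Ck_fst R R R 1 setT).1 p I.
have d : differentiable (fun q : plane => h q.1) p.
  exact: (@differentiable_comp _ _ _ _ (fst : plane -> R) h).
apply: DeriveDef; first exact: diff_derivable.
rewrite deriveE // (diff_comp fd hd) /= diff1E // -derive1E.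
rewrite (_ : 'd fst p v = v.1) // diff_lin //.
by move=> x; exact: cvg_fst.
Qed.

Lemma is_derive_snd (p v : plane) : is_derive p v (snd : plane -> R) v.2.
Proof.
have d : differentiable (snd : plane -> R) p := (@Ck_snd R R R 1 setT).1 p I.
apply: DeriveDef; first exact: diff_derivable.
rewrite deriveE // diff_lin //.
by move=> x; exact: cvg_snd.
Qed.

Lemma derive_compE (V1 V2 W : normedModType R) (f : V1 -> V2) (g : V2 -> W) p v :
  differentiable f p -> differentiable g (f p) ->
  'D_v (g \o f) p = 'D_('D_v f p) g (f p).
Proof.
move=> fd gd; rewrite [LHS]deriveE; last exact: differentiable_comp.
by rewrite (diff_comp fd gd) [RHS]deriveE // [in RHS]deriveE.
Qed.

Lemma is_derive_cvgP (V W : normedModType R) (f : V -> W) p v df :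
  is_derive p v f df <->
  (fun h : R => h^-1 *: (f (h *: v + p) - f p)) @ 0^' --> df.
Proof.
split=> [[fd <-]|H]; first exact: fd.
by apply: DeriveDef; [apply/cvg_ex; exists df|exact: cvg_lim H].
Qed.

Lemma is_derive_pair (V W1 W2 : normedModType R) (f : V -> W1) (g : V -> W2) p v df dg :
  is_derive p v f df -> is_derive p v g dg ->
  is_derive p v (fun q => (f q, g q)) (df, dg).
Proof.
by move=> /is_derive_cvgP fd /is_derive_cvgP gd; apply/is_derive_cvgP/cvg_pair.
Qed.

Lemma is_derive_pair1 (V W1 W2 : normedModType R) (f : V -> W1 * W2) p v df :
  is_derive p v f df -> is_derive p v (fun q => (f q).1) df.1.
Proof.
move=> /is_derive_cvgP fd; apply/is_derive_cvgP.
have c : continuous (fst : W1 * W2 -> W1) by move=> x; exact: cvg_fst.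
exact: (cvg_comp _ _ fd (c df)).
Qed.

Lemma is_derive_pair2 (V W1 W2 : normedModType R) (f : V -> W1 * W2) p v df :
  is_derive p v f df -> is_derive p v (fun q => (f q).2) df.2.
Proof.
move=> /is_derive_cvgP fd; apply/is_derive_cvgP.
have c : continuous (snd : W1 * W2 -> W2) by move=> x; exact: cvg_snd.
exact: (cvg_comp _ _ fd (c df)).
Qed.

Lemma nablaE (mu : plane -> R) (X Y : plane -> plane) p :
  nabla mu X Y p =
  (('D_(X p) Y p).1 + ((X p).1 * (Y p).2 + (X p).2 * (Y p).1) / (2 * p.2),
   ('D_(X p) Y p).2 + (X p).1 * (Y p).1 * mu p - (X p).2 * (Y p).2 / (2 * p.2)).
Proof.
rewrite /nabla; set A := (X p).1 * (Y p).1 * mu p; set B := _ / _; set C := _ / _.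
apply/pair_equal_spec; split => /=.
  rewrite -[LHS]/(('D_(X p) Y p).1 + A * 0 + B * 1 - C * 0); ring.
rewrite -[LHS]/(('D_(X p) Y p).2 + A * 1 + B * 0 - C * 1); ring.
Qed.

(** * Transformation of the connection under one local diffeomorphism *)

Section Act.
Variable phi : partial_map R.
Hypothesis phiP : local_diffeo phi.
Let f := pfwd phi.
Let a := derive1 f.
Let b := derive1 a.
Let c := derive1 b.
Let U := lift_dom phi.
Let F := act_cotangent phi.

Let oD : open (pdom phi). Proof. by case: phiP => -[]. Qed.
Let oU : open U. Proof. exact: open_lift_dom. Qed.
Let fC : smooth (pdom phi) f. Proof. by case: phiP. Qed.
Let aC : smooth (pdom phi) a. Proof. exact: smooth_derive1. Qed.
Let bC : smooth (pdom phi) b. Proof. exact: smooth_derive1. Qed.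
Let a_gt0 x : pdom phi x -> 0 < a x. Proof. by case: phiP => ? ? ? ?; exact. Qed.
Let a_neq0 x : pdom phi x -> a x != 0. Proof. by move/a_gt0/gt_eqF/negbT. Qed.

Lemma smooth_fst_comp (h : R -> R) : smooth (pdom phi) h -> smooth U (fun p => h p.1).
Proof.
move=> hC n; apply: Ck_comp1 (hC n) _ => //; last exact: Ck_fst.
by move=> p [].
Qed.

Lemma smooth_act : smooth U F.
Proof.
move=> n; apply: Ck_pair => //; first exact: smooth_fst_comp.
apply: CkM => //; first exact: Ck_snd.
apply: CkV => //; last exact: smooth_fst_comp.
by move=> p [/a_neq0].
Qed.

Lemma derive_act p v : U p ->
  'D_v F p = (a p.1 * v.1, v.2 / a p.1 - p.2 * b p.1 / a p.1 ^+ 2 * v.1).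
Proof.
move=> Up; have [Dp _] := Up.
have fd := is_derive_fst v (smooth_derivable1 fC Dp).
have ad := is_derive_fst v (is_deriveV (a_neq0 Dp) (smooth_derivable1 aC Dp)).
have [_ E] := is_derive_pair fd (is_deriveM (is_derive_snd p v) ad).
rewrite [LHS]E -/a -/b; apply/pair_equal_spec; split; first exact: mulrC.
have alg (y w1 w2 A B : R) : A != 0 ->
    y * (w1 * (- A ^- 2 * B)) + A^-1 * w2 = w2 / A - y * B / A ^+ 2 * w1.
  by move=> ?; field.
exact: alg (a_neq0 Dp).
Qed.

(** The constants 1/2 in the connection are chosen so that every other discrepancy cancels: what
    remains is tensorial in [X] and [Y], involves only their first components, and points along
    [d2]. *)
Lemma nabla_act (mu : plane -> R) (X Y X' Y' : plane -> plane) p :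
  U p -> differentiable Y p -> differentiable Y' (F p) ->
  related U F X X' -> related U F Y Y' ->
  'D_(nabla mu X Y p) F p = nabla mu X' Y' (F p)
    + (0, (X p).1 * (Y p).1 / a p.1 *
          (mu p + p.2 * schwarzian f p.1 - a p.1 ^+ 3 * mu (F p))).
Proof.
move=> Up dY dY' relX relY; have [Dp p20] := Up.
have p2 : p.2 != 0 by rewrite gt_eqF.
have a0 := a_neq0 Dp.
have dF : differentiable F p := smooth_differentiable smooth_act Up.
have XE := relX p Up; have YE := relY p Up.
(* [G] is the Jacobian applied to [Y], hence equals [Y' \o F] near [p]. By the chain rule the
   derivative of [Y'] along [X'] at [F p] is that of [G] along [X] at [p], which involves only [Y]
   and [phi]. *)
pose G q : plane :=
  (a q.1 * (Y q).1, (Y q).2 / a q.1 - q.2 * b q.1 / a q.1 ^+ 2 * (Y q).1).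
have GE : \forall q \near p, (Y' \o F) q = G q.
  apply: filterS (open_nbhs_nbhs (conj oU Up)) => q Uq.
  by rewrite /= -relY // derive_act.
have DY' : 'D_(X' (F p)) Y' (F p) = 'D_(X p) G p.
  have E1 := near_eq_derive (X p) GE.
  have E2 := derive_compE (X p) dF dY'.
  rewrite -E1 E2; exact: (congr1 (fun v => 'D_v Y' (F p)) (esym XE)).
have Yd : is_derive p (X p) Y ('D_(X p) Y p) by exact/derivableP/diff_derivable.
set w := 'D_(X p) Y p in Yd *.
have ad := is_derive_fst (X p) (smooth_derivable1 aC Dp).
have bd := is_derive_fst (X p) (smooth_derivable1 bC Dp).
have iad := is_derive_fst (X p) (is_deriveV a0 (smooth_derivable1 aC Dp)).
have sd := is_derive_snd p (X p).
have Y1d := is_derive_pair1 Yd; have Y2d := is_derive_pair2 Yd.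
have dG := is_derive_pair (is_deriveM ad Y1d)
  (is_deriveB (is_deriveM Y2d iad)
     (is_deriveM (is_deriveM (is_deriveM sd bd) (is_deriveM iad iad)) Y1d)).
have {dG} [_ dG] := dG.
(* The quotients are rewritten as products of inverses, the form to which the product rule above was
   applied. *)
have GE2 : G = (fun q : plane => (a q.1 * (Y q).1,
   (Y q).2 * (a q.1)^-1 - q.2 * b q.1 * ((a q.1)^-1 * (a q.1)^-1) * (Y q).1)).
  by apply/funext => q; rewrite /G expr2 invfM.
rewrite -GE2 -DY' in dG.
rewrite derive_act // [nabla mu X Y p]nablaE [nabla mu X' Y' _]nablaE dG -/w -XE -YE.
rewrite !derive_act //.
rewrite (schwarzianE fC Dp a0) -/a -/b.
rewrite -[RHS]/(_ + _, _ + _) -![_ *: _]/(_ * _) /F /act_cotangent /=.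
apply/pair_equal_spec; split.
  have alg (A B y x1 x2 y1 y2 w1 : R) : A != 0 -> y != 0 ->
      A * (w1 + (x1 * y2 + x2 * y1) / (2 * y)) =
      A * w1 + y1 * (x1 * B) +
      (A * x1 * (y2 / A - y * B / A ^+ 2 * y1)
       + (x2 / A - y * B / A ^+ 2 * x1) * (A * y1)) / (2 * (y / A)) + 0.
    by move=> A0 y0; field; rewrite A0 y0.
  exact: (alg (a p.1) (b p.1) p.2 (X p).1 (X p).2 (Y p).1 (Y p).2 w.1 a0 p2).
have alg (A B C y x1 x2 y1 y2 w1 w2 m m' : R) : A != 0 -> y != 0 ->
    (w2 + x1 * y1 * m - x2 * y2 / (2 * y)) / A
    - y * B / A ^+ 2 * (w1 + (x1 * y2 + x2 * y1) / (2 * y)) =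
    y2 * (x1 * (- A ^- 2 * B)) + A^-1 * w2 -
    (y * B * (A^-1 * A^-1) * w1 +
     y1 * (y * B * (A^-1 * (x1 * (- A ^- 2 * B)) + A^-1 * (x1 * (- A ^- 2 * B)))
           + A^-1 * A^-1 * (y * (x1 * C) + B * x2))) +
    A * x1 * (A * y1) * m' -
    (x2 / A - y * B / A ^+ 2 * x1) * (y2 / A - y * B / A ^+ 2 * y1)
    / (2 * (y / A)) +
    x1 * y1 / A * (m + y * (C / A - 3 / 2 * (B / A) ^+ 2) - A ^+ 3 * m').
  by move=> A0 y0; field; rewrite A0 y0.
exact: (alg (a p.1) (b p.1) (c p.1) p.2 (X p).1 (X p).2 (Y p).1 (Y p).2
  w.1 w.2 (mu p) _ a0 p2).
Qed.

Lemma preserves_nabla (mu : plane -> R) :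
  preserves U F (nabla mu) <->
  forall p, U p -> a p.1 ^+ 3 * mu (F p) = mu p + p.2 * schwarzian f p.1.
Proof.
split=> [FP p Up|FP X Y X' Y' XC YC X'C Y'C relX relY p Up]; last first.
  rewrite (nabla_act mu Up _ _ relX relY); last 2 first.
  - exact: smooth_differentiable YC Up.
  - by apply: smooth_differentiable Y'C _; exists p.
  by rewrite FP // subrr mulr0 (_ : (0, 0) = 0) // addr0.
(* The pullback of the constant field [d1] by [F]. Its first component 1/a never vanishes, so the
   error term of [nabla_act] for the pair (X, X) forces the bracket to be zero. *)
pose X q : plane := ((a q.1)^-1, q.2 * (b q.1 * ((a q.1)^-1 * (a q.1)^-1))).
pose X' (q : plane) := d1 R.
have aiC : smooth U (fun q => (a q.1)^-1).
  move=> n; apply: CkV => //; last exact: smooth_fst_comp.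
  by move=> q [/a_neq0].
have XC : smooth U X.
  move=> n; apply: Ck_pair => //.
  apply: CkM => //; first exact: Ck_snd.
  by do !apply: CkM => //; exact: smooth_fst_comp.
have X'C : smooth (F @` U) X' by move=> n; exact: Ck_cst.
have relX : related U F X X'.
  move=> q Uq; have aq := a_neq0 Uq.1; rewrite derive_act // /X' /d1 /X /=.
  apply/pair_equal_spec; split; first by rewrite mulfV.
  have alg (A B y : R) : A != 0 ->
    y * (B * (A^-1 * A^-1)) / A - y * B / A ^+ 2 * A^-1 = 0 by move=> A0; field.
  exact: alg.
have := FP X X X' X' XC XC X'C X'C relX relX p Up.
rewrite (nabla_act mu Up _ _ relX relX); last 2 first.
- exact: smooth_differentiable XC Up.
- by apply: smooth_differentiable X'C _; exists p.
move/eqP; rewrite -subr_eq0 addrAC subrr add0r => /eqP[/eqP].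
have aq := a_neq0 Up.1.
by rewrite !mulf_eq0 !invr_eq0 (negbTE aq) /= subr_eq0 => /eqP.
Qed.

End Act.

Definition schwarzian_cocycle (Gamma : set (partial_map R)) (w : plane -> R) :=
  forall phi, Gamma phi -> forall p, lift_dom phi p ->
    w (act_frame phi p) = w p + p.2 ^+ 2 * schwarzian (pfwd phi) p.1.

(** An involution on the half plane, so the same formula passes from mu to w and back. The cube
    absorbs the factor a^3 of [preserves_nabla], as y becomes a y under [act_frame]. *)
Let swap (g : plane -> R) (q : plane) : R := q.2 ^+ 3 * g (q.1, q.2^-1).

Lemma smooth_swap g : smooth half_plane g -> smooth half_plane (swap g).
Proof.
move=> gC n.
have oH := open_half_plane.
have sC : Ck n half_plane (snd : plane -> R) by exact: Ck_snd.
apply: CkM => //.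
  exact: (CkM oH sC (CkM oH sC sC)).
apply: (@Ck_comp2 _ _ _ _ _ g fst (fun q : plane => q.2^-1) oH _ (gC n)).
- by move=> p p2; rewrite /half_plane /= invr_gt0.
- exact: Ck_fst.
- by apply: CkV => // p /gt_eqF/negbT.
Qed.

Lemma invariant_connectionP (Gamma : set (partial_map R)) : pseudogroup Gamma ->
  (exists mu, smooth half_plane mu /\ invariant_connection Gamma (nabla mu)) <->
  (exists w, smooth half_plane w /\ schwarzian_cocycle Gamma w).
Proof.
move=> GP; split=> -[g [gC gP]]; exists (swap g); split; try exact: smooth_swap.
  move=> phi Gphi p [Dp p2]; have phiP := pseudogroup_diffeo GP Gphi.
  have p20 : p.2 != 0 by rewrite gt_eqF.
  have Up : lift_dom phi (p.1, p.2^-1) by split=> //; rewrite /half_plane /= invr_gt0.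
  have /= := (preserves_nabla phiP g).1 (gP _ Gphi) _ Up.
  rewrite /swap /act_frame /act_cotangent /= invfM [_^-1 / _]mulrC.
  have alg (a y v v' s : R) : y != 0 -> a ^+ 3 * v' = v + y^-1 * s ->
    (a * y) ^+ 3 * v' = y ^+ 3 * v + y ^+ 2 * s.
    by move=> y0 E; rewrite exprMn [_ * y ^+ 3]mulrC -mulrA E; field.
  exact: alg.
move=> phi Gphi; have phiP := pseudogroup_diffeo GP Gphi.
apply/(preserves_nabla phiP) => p [Dp p2].
have p20 : p.2 != 0 by rewrite gt_eqF.
have Up : lift_dom phi (p.1, p.2^-1) by split=> //; rewrite /half_plane /= invr_gt0.
have := gP _ Gphi _ Up; rewrite /act_frame /swap /act_cotangent /= invf_div => ->.
have a0 : derive1 (pfwd phi) p.1 != 0.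
  by case: phiP => _ _ _ _ /(_ _ Dp)/gt_eqF/negbT.
have alg (a y v s : R) : a != 0 -> y != 0 ->
  a ^+ 3 * ((y / a) ^+ 3 * (v + y^-1 ^+ 2 * s)) = y ^+ 3 * v + y * s.
  by move=> ? ?; field; apply/andP.
exact: alg.
Qed.

End Connection.

(** * Germs and convolution *)

Section Germs.
Variable R : realType.
Local Notation plane := (R * R)%type.
Local Notation half_plane := (@half_plane R).
Implicit Types phi psi chi : partial_map R.

Lemma near_refl (f : R -> R) (x : R) : \forall t \near x, f t = f t.
Proof. by near=> t.
Unshelve. all: by end_near. Qed.

Lemma germ_near phi psi x : (\forall t \near x, pfwd phi t = pfwd psi t) ->
  germ phi x = germ psi x.
Proof.
move=> H; apply/seteqP; split=> chi [chiP chix chiE]; split=> //.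
  by apply: filterS2 H chiE => t <-.
by apply: filterS2 H chiE => t ->.
Qed.

(** [phi] belongs to its own germ, so equality of the classes puts it in the germ of [psi]. *)
Lemma germ_inj phi psi x : local_diffeo phi -> pdom phi x ->
  germ phi x = germ psi x -> \forall t \near x, pfwd phi t = pfwd psi t.
Proof.
move=> phiP Dx E; have : germ phi x phi by split=> //; exact: near_refl.
by rewrite E => -[].
Qed.

Lemma near_derive1 (f g : R -> R) (x : R) : (\forall t \near x, f t = g t) ->
  \forall t \near x, derive1 f t = derive1 g t.
Proof.
move=> /nbhs_interior; apply: filterS => t fg.
by rewrite !derive1E; exact: near_eq_derive.
Qed.

Lemma act_frame_near phi psi (p : plane) :
  (\forall t \near p.1, pfwd phi t = pfwd psi t) ->
  act_frame phi p = act_frame psi p.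
Proof.
move=> H; rewrite /act_frame (nbhs_singleton H).
by rewrite (nbhs_singleton (near_derive1 H)).
Qed.

Lemma pfwd_cts phi x : local_diffeo phi -> pdom phi x -> {for x, continuous (pfwd phi)}.
Proof. by case=> _ _ /(_ 0) + _ _; apply. Qed.

Lemma pbwd_cts phi x : local_diffeo phi -> pdom phi x ->
  {for pfwd phi x, continuous (pbwd phi)}.
Proof. by case=> _ _ _ /(_ 0) fC _ Dx; apply: fC; exists x. Qed.

Lemma pdom_near phi x : local_diffeo phi -> pdom phi x -> nbhs x (pdom phi).
Proof. by case=> -[oD _] _ _ _ _ Dx; exact: open_nbhs_nbhs. Qed.

Lemma near_pfwd phi x (P : R -> Prop) : local_diffeo phi -> pdom phi x ->
  (\forall t \near pfwd phi x, P t) -> \forall t \near x, P (pfwd phi t).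
Proof. by move=> phiP Dx; exact: pfwd_cts. Qed.

Lemma near_pbwd phi x (P : R -> Prop) : local_diffeo phi -> pdom phi x ->
  (\forall t \near x, P t) -> \forall t \near pfwd phi x, P (pbwd phi t).
Proof.
move=> phiP Dx; have bK : pbwd phi (pfwd phi x) = x by case: phiP => _ /(_ _ Dx).
by rewrite -{1}bK; exact: pbwd_cts.
Qed.

Lemma pfwdK_near phi x : local_diffeo phi -> pdom phi x ->
  \forall t \near x, pbwd phi (pfwd phi t) = t.
Proof.
move=> phiP Dx; apply: filterS (pdom_near phiP Dx) => t.
by case: phiP => _ + _ _ _; apply.
Qed.

Lemma pbwdK_near phi x : local_diffeo phi -> pdom phi x ->
  \forall t \near pfwd phi x, pfwd phi (pbwd phi t) = t.
Proof.
move=> phiP Dx; case: (phiP) => -[_ oE] bK _ _ _.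
have Ex : prange phi (pfwd phi x) by exists x.
by apply: filterS (open_nbhs_nbhs (conj oE Ex)) => _ [t Dt <-]; rewrite bK.
Qed.

Lemma pfwd_derive phi x : local_diffeo phi -> pdom phi x ->
  is_derive x 1 (pfwd phi) (derive1 (pfwd phi) x).
Proof. by move=> phiP Dx; apply: (@smooth_derivable1 _ (pdom phi)) => //; case: phiP. Qed.

Lemma derive1_pbwd phi x : local_diffeo phi -> pdom phi x ->
  derive1 (pbwd phi) (pfwd phi x) * derive1 (pfwd phi) x = 1.
Proof.
move=> phiP Dx.
have bd : is_derive (pfwd phi x) 1 (pbwd phi) (derive1 (pbwd phi) (pfwd phi x)).
  by apply: (@smooth_derivable1 _ (prange phi)) => //; [case: phiP|exists x].
have [_ <-] := is_derive1_comp bd (pfwd_derive phiP Dx).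
rewrite -derive1E (nbhs_singleton (near_derive1 (pfwdK_near phiP Dx))).
exact: derive1_id.
Qed.

Lemma derive1_pfwd_gt0 phi x : local_diffeo phi -> pdom phi x ->
  0 < derive1 (pfwd phi) x.
Proof. by case=> _ _ _ _; apply. Qed.

Lemma act_frame_id (p : plane) : act_frame (pidentity R) p = p.
Proof. by rewrite /act_frame /= derive1_id mul1r; case: p. Qed.

Lemma lift_dom_act phi p : local_diffeo phi -> lift_dom phi p ->
  half_plane (act_frame phi p).
Proof.
by move=> phiP [Dp p2]; rewrite /half_plane /= mulr_gt0 //; exact: derive1_pfwd_gt0.
Qed.

Lemma act_frame_comp phi psi p : local_diffeo phi -> local_diffeo psi ->
  lift_dom psi p -> lift_dom phi (act_frame psi p) ->
  act_frame (pcompose phi psi) p = act_frame phi (act_frame psi p).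
Proof.
move=> phiP psiP [Dp p2] [Dq q2]; rewrite /act_frame /=; congr (_, _).
rewrite derive1_comp ?mulrA //.
  by have [] := pfwd_derive psiP Dp.
by have [] := pfwd_derive phiP Dq.
Qed.

Lemma lift_dom_comp phi psi p :
  lift_dom psi p -> lift_dom phi (act_frame psi p) -> lift_dom (pcompose phi psi) p.
Proof. by move=> [Dp p2] [Dq q2]; split. Qed.

Lemma lift_dom_inv phi p : local_diffeo phi -> lift_dom phi p ->
  lift_dom (pinverse phi) (act_frame phi p).
Proof.
by move=> phiP Up; split; [case: Up => Dp _; exists p.1|exact: lift_dom_act].
Qed.

Lemma act_frameK phi p : local_diffeo phi -> lift_dom phi p ->
  act_frame (pinverse phi) (act_frame phi p) = p.
Proof.
move=> phiP [Dp p2]; rewrite /act_frame /= mulrA derive1_pbwd // mul1r.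
by case: (phiP) => _ -> // _ _ _; case: p {Dp p2}.
Qed.

Lemma lift_dom_invP phi q : local_diffeo phi -> lift_dom (pinverse phi) q ->
  exists2 p, lift_dom phi p & act_frame phi p = q.
Proof.
move=> phiP [[x Dx xq] q2].
have a0 := derive1_pfwd_gt0 phiP Dx.
exists (x, q.2 / derive1 (pfwd phi) x).
  by split=> //; rewrite /half_plane /= divr_gt0.
by rewrite /act_frame /= xq mulrCA mulfV ?gt_eqF // mulr1; case: (q).
Qed.

Lemma image_act phi : local_diffeo phi ->
  act_frame phi @` lift_dom phi = lift_dom (pinverse phi).
Proof.
move=> phiP; apply/seteqP; split=> [_ [p Up <-]|q]; first exact: lift_dom_inv.
by move=> /(lift_dom_invP phiP)[p Up <-]; exists p.
Qed.

(** The representative picked by [xget] is a local diffeomorphism with the right germ; it may lie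
    outside [Gamma], so arguments about it must be local. *)
Lemma arrow_repP phi (p : plane) : local_diffeo phi -> pdom phi p.1 ->
  [/\ local_diffeo (arrow_rep (mk_arrow phi p)),
      pdom (arrow_rep (mk_arrow phi p)) p.1 &
      \forall t \near p.1, pfwd (arrow_rep (mk_arrow phi p)) t = pfwd phi t].
Proof.
move=> phiP Dp; rewrite /arrow_rep /=.
have : germ phi p.1 (xget (pidentity R) (germ phi p.1)).
  by apply: (xgetI _ (_ : germ phi p.1 phi)); split=> //; exact: near_refl.
by case.
Qed.

Lemma arrow_targetE phi (p : plane) : local_diffeo phi -> pdom phi p.1 ->
  arrow_target (mk_arrow phi p) = act_frame phi p.
Proof.
by move=> phiP Dp; have [_ _ H] := arrow_repP phiP Dp; exact: act_frame_near.
Qed.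

Lemma mk_arrow_near phi psi (p : plane) :
  (\forall t \near p.1, pfwd phi t = pfwd psi t) -> mk_arrow phi p = mk_arrow psi p.
Proof. by move=> H; rewrite /mk_arrow (germ_near H). Qed.

Lemma mk_arrow_inj phi psi (p q : plane) : local_diffeo phi -> pdom phi p.1 ->
  mk_arrow phi p = mk_arrow psi q ->
  p = q /\ \forall t \near p.1, pfwd phi t = pfwd psi t.
Proof. by move=> phiP Dp [<- E]; split=> //; exact: germ_inj. Qed.

Lemma fU_mk (f : plane -> R[i]) phi p : lift_dom phi p ->
  fU f phi (mk_arrow phi p) = f (act_frame phi p).
Proof. by move=> Up; rewrite /fU asboolT. Qed.

Lemma fU_neq0 (f : plane -> R[i]) phi c : fU f phi c <> 0 ->
  lift_dom phi c.1 /\ c = mk_arrow phi c.1.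
Proof. by rewrite /fU; case: asboolP. Qed.

Lemma fsbig_single (T : choiceType) (V : nmodType) (A : set T) (F : T -> V) x :
  A x -> (forall y, A y -> y <> x -> F y = 0) -> \sum_(y \in A) F y = F x.
Proof.
move=> Ax H; transitivity (\sum_(y \in [set x]) F y); last exact: fsbig_set1.
apply/esym/fsbig_widen => [_ -> //|y [Ay yx]].
exact: H.
Qed.

End Germs.

(** * Convolution with elements f U_phi and with functions on the units *)

Section Convolution.
Variable R : realType.
Local Notation plane := (R * R)%type.
Local Notation half_plane := (@half_plane R).
Implicit Types phi psi chi : partial_map R.
Variable Gamma : set (partial_map R).
Hypothesis GammaP : pseudogroup Gamma.

Let dif phi : Gamma phi -> local_diffeo phi. Proof. exact: pseudogroup_diffeo. Qed.

Lemma act_frame_inj phi (p q : plane) : local_diffeo phi ->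
  lift_dom phi p -> lift_dom phi q -> act_frame phi p = act_frame phi q -> p = q.
Proof.
by move=> phiP Up Uq E; rewrite -(act_frameK phiP Up) E act_frameK.
Qed.

Lemma mk_arrow_pcompose_inj phi psi phi' psi' (p p' : plane) :
  local_diffeo (pcompose phi psi) -> lift_dom psi p -> lift_dom phi (act_frame psi p) ->
  mk_arrow (pcompose phi psi) p = mk_arrow (pcompose phi' psi') p' ->
  p = p' /\ \forall t \near p.1, pfwd phi (pfwd psi t) = pfwd phi' (pfwd psi' t).
Proof. by move=> phipsiP [Dp _] [Dq _]; apply: mk_arrow_inj. Qed.

Lemma groupoid_mk_arrow phi p : Gamma phi -> lift_dom phi p ->
  groupoid Gamma (mk_arrow phi p).
Proof. by move=> Gphi Up; exists phi, p. Qed.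

Lemma groupoidP c : groupoid Gamma c ->
  exists phi, [/\ Gamma phi, lift_dom phi c.1 & c = mk_arrow phi c.1].
Proof. by move=> [phi [p [Gphi Up ->]]]; exists phi. Qed.

Lemma fU_groupoid f phi c : Gamma phi -> fU f phi c <> 0 -> groupoid Gamma c.
Proof. by move=> Gphi /fU_neq0[Up ->]; exact: groupoid_mk_arrow. Qed.

Lemma convol_out a b c : ~ groupoid Gamma c -> convol Gamma a b c = 0.
Proof.
move=> nc; rewrite /convol (_ : factorizations _ _ = set0) ?fsbig_set0 //.
apply/seteqP; split=> // q [phi [psi [p [[Gphi Gpsi] [Up Uq] _ E]]]].
apply: nc; rewrite E; apply: groupoid_mk_arrow; last exact: lift_dom_comp.
exact: pseudogroup_comp.
Qed.

Lemma factorizations_mk phi psi p : Gamma phi -> Gamma psi -> lift_dom psi p ->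
  lift_dom phi (act_frame psi p) ->
  factorizations Gamma (mk_arrow (pcompose phi psi) p)
    (mk_arrow phi (act_frame psi p), mk_arrow psi p).
Proof. by move=> Gphi Gpsi Up Uq; exists phi, psi, p. Qed.

(* Only the factorization through the arrow of phi contributes, because
   right translation by an arrow is injective. *)
Lemma convol_fU Omega f psi phi p : Gamma psi -> Gamma phi -> lift_dom phi p ->
  lift_dom psi (act_frame phi p) ->
  convol Gamma Omega (fU f phi) (mk_arrow (pcompose psi phi) p) =
  Omega (mk_arrow psi (act_frame phi p)) * f (act_frame phi p).
Proof.
move=> Gpsi Gphi Up Uq; rewrite /convol.
rewrite (fsbig_single (factorizations_mk Gpsi Gphi Up Uq)) /= ?fU_mk //.
move=> y [psi' [phi' [p' [[Gpsi' Gphi'] [Up' Uq'] -> E]]]] ne /=.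
have [fU0|/eqP/fU_neq0[Up2 E2]] := eqVneq (fU f phi (mk_arrow phi' p')) 0.
  by rewrite fU0 mulr0.
have GP := dif (pseudogroup_comp GammaP Gpsi Gphi).
have [pp' nE] := mk_arrow_pcompose_inj GP Up Uq E; subst p'.
have [_ phiE] := mk_arrow_inj (dif Gphi') Up'.1 E2.
case: ne; rewrite (act_frame_near phiE) E2 /=; congr (_, _).
apply: mk_arrow_near; have [Dp _] := Up.
have nE' : \forall t \near p.1, pfwd psi (pfwd phi t) = pfwd psi' (pfwd phi t).
  by apply: filterS2 nE phiE => t -> ->.
(* Precomposing with [pbwd phi] cancels [phi] on the right and leaves equality of the germs of [psi]
   and [psi'] at the intermediate point. *)
have H1 : \forall t \near pfwd phi p.1,
    pfwd psi (pfwd phi (pbwd phi t)) = pfwd psi' (pfwd phi (pbwd phi t)).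
  exact: near_pbwd (dif Gphi) Dp nE'.
by apply: filterS2 (pbwdK_near (dif Gphi) Dp) H1 => t ->.
Qed.

(** Here [phi] is cancelled on the left. The intermediate point of a competing factorization is not
    given in advance; it is recovered from the common target by injectivity of [act_frame phi]. *)
Lemma fU_convol Omega f phi psi p : Gamma phi -> Gamma psi -> lift_dom psi p ->
  lift_dom phi (act_frame psi p) ->
  convol Gamma (fU f phi) Omega (mk_arrow (pcompose phi psi) p) =
  f (act_frame phi (act_frame psi p)) * Omega (mk_arrow psi p).
Proof.
move=> Gphi Gpsi Up Uq; rewrite /convol.
rewrite (fsbig_single (factorizations_mk Gphi Gpsi Up Uq)) /= ?fU_mk //.
move=> y [phi' [psi' [p' [[Gphi' Gpsi'] [Up' Uq'] -> E]]]] ne /=.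
set q' := act_frame psi' p' in Uq' *.
have [fU0|/eqP/fU_neq0[Uq2 E2]] := eqVneq (fU f phi (mk_arrow phi' q')) 0.
  by rewrite fU0 mul0r.
have GP := dif (pseudogroup_comp GammaP Gphi Gpsi).
have [pp' nE] := mk_arrow_pcompose_inj GP Up Uq E; subst p'.
have [_ phiE] := mk_arrow_inj (dif Gphi') Uq'.1 E2.
have nE' : \forall t \near p.1, pfwd phi (pfwd psi t) = pfwd phi (pfwd psi' t).
  apply: filterS2 nE (near_pfwd (dif Gpsi') Up'.1 phiE) => t -> ->.
  by [].
have nact : act_frame phi q' = act_frame phi (act_frame psi p).
  rewrite /q' -!act_frame_comp //; try exact: dif.
  by apply/esym/act_frame_near.
have qE : q' = act_frame psi p by apply: (act_frame_inj (dif Gphi)).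
case: ne; rewrite E2 /= qE; congr (_, _).
apply: mk_arrow_near.
have K : \forall t \near p.1, pbwd phi (pfwd phi (pfwd psi t)) = pfwd psi t.
  exact: near_pfwd (dif Gpsi) Up.1 (pfwdK_near (dif Gphi) Uq.1).
have K' : \forall t \near p.1, pbwd phi (pfwd phi (pfwd psi' t)) = pfwd psi' t.
  exact: near_pfwd (dif Gpsi') Up'.1 (pfwdK_near (dif Gphi) Uq2.1).
have K2 : \forall t \near p.1, pbwd phi (pfwd phi (pfwd psi' t)) = pfwd psi t.
  by apply: filterS2 nE' K => t ->.
by apply: filterS2 K' K2 => t e1 e2; exact: etrans (esym e1) e2.
Qed.

Definition unit_arrow (p : plane) : arrow R := mk_arrow (pidentity R) p.

Lemma local_diffeo_id : local_diffeo (pidentity R).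
Proof. exact: dif (pseudogroup_id GammaP). Qed.

Lemma lift_dom_id (p : plane) : half_plane p -> lift_dom (pidentity R) p.
Proof. by []. Qed.

(** The function w regarded as a multiplier: it multiplies by the value of w at the target when
    convolved from the left, and at the source when convolved from the right. *)
Definition unit_fun (w : plane -> R[i]) : gfun R :=
  fun c => if `[< half_plane c.1 /\ c = unit_arrow c.1 >] then w c.1 else 0.

Lemma unit_fun_mk w p : half_plane p -> unit_fun w (unit_arrow p) = w p.
Proof. by move=> Hp; rewrite /unit_fun asboolT. Qed.

Lemma unit_fun_neq0 w c : unit_fun w c <> 0 -> half_plane c.1 /\ c = unit_arrow c.1.
Proof. by rewrite /unit_fun; case: asboolP. Qed.

Lemma unit_fun_convol w a phi p : Gamma phi -> lift_dom phi p ->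
  convol Gamma (unit_fun w) a (mk_arrow phi p) = w (act_frame phi p) * a (mk_arrow phi p).
Proof.
move=> Gphi Up.
have Uq : lift_dom (pidentity R) (act_frame phi p).
  by split=> //; exact: lift_dom_act (dif Gphi) Up.
have Gid := pseudogroup_id GammaP.
have cE : mk_arrow phi p = mk_arrow (pcompose (pidentity R) phi) p.
  by apply: mk_arrow_near; exact: near_refl.
rewrite /convol {1}cE (fsbig_single (factorizations_mk Gid Gphi Up Uq)) /=.
  by rewrite unit_fun_mk //; case: Uq.
move=> y [psi [phi' [p' [[Gpsi Gphi'] [Up' Uq'] -> E]]]] ne /=.
set q' := act_frame phi' p' in Uq' *.
have [w0|/eqP/unit_fun_neq0[Uq2 E2]] := eqVneq (unit_fun w (mk_arrow psi q')) 0.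
  by rewrite w0 mul0r.
have GP := dif (pseudogroup_comp GammaP Gid Gphi).
have [pp' nE] := mk_arrow_pcompose_inj GP Up Uq E; subst p'.
have [_ psiE] := mk_arrow_inj (dif Gpsi) Uq'.1 E2.
have phiE : \forall t \near p.1, pfwd phi t = pfwd phi' t.
  by apply: filterS2 nE (near_pfwd (dif Gphi') Up'.1 psiE) => t /= -> ->.
case: ne; rewrite E2 /q' (act_frame_near phiE); congr (_, _).
by apply: mk_arrow_near; apply: filterS phiE.
Qed.

Lemma convol_unit_fun w a phi p : Gamma phi -> lift_dom phi p ->
  convol Gamma a (unit_fun w) (mk_arrow phi p) = a (mk_arrow phi p) * w p.
Proof.
move=> Gphi Up.
have Uid : lift_dom (pidentity R) p by split=> //; case: Up.
have Uq : lift_dom phi (act_frame (pidentity R) p) by rewrite act_frame_id.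
have Gid := pseudogroup_id GammaP.
have cE : mk_arrow phi p = mk_arrow (pcompose phi (pidentity R)) p.
  by apply: mk_arrow_near; exact: near_refl.
rewrite /convol {1}cE (fsbig_single (factorizations_mk Gphi Gid Uid Uq)) /=.
  by rewrite unit_fun_mk ?act_frame_id //; case: Up.
move=> y [phi' [psi [p' [[Gphi' Gpsi] [Up' Uq'] -> E]]]] ne /=.
have [w0|/eqP/unit_fun_neq0[Uq2 E2]] := eqVneq (unit_fun w (mk_arrow psi p')) 0.
  by rewrite w0 mulr0.
have GP := dif (pseudogroup_comp GammaP Gphi Gid).
have [pp' nE] := mk_arrow_pcompose_inj GP Uid Uq E; subst p'.
have [_ psiE] := mk_arrow_inj (dif Gpsi) Up'.1 E2.
case: ne; rewrite E2 (act_frame_near psiE) act_frame_id; congr (_, _).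
by apply: mk_arrow_near; apply: filterS2 nE psiE => t /= -> ->.
Qed.

End Convolution.

(** * The operator delta_2' *)

Section Action.
Variable R : realType.
Local Notation plane := (R * R)%type.
Local Notation half_plane := (@half_plane R).
Implicit Types phi psi chi : partial_map R.
Variable Gamma : set (partial_map R).
Hypothesis GammaP : pseudogroup Gamma.

Let dif phi : Gamma phi -> local_diffeo phi. Proof. exact: pseudogroup_diffeo. Qed.

(** [mu_inv] is built from the backward maps, whereas germs record the forward maps only; this
    transfers agreement from one to the other. *)
Lemma pbwd_near phi psi x : local_diffeo phi -> local_diffeo psi ->
  pdom phi x -> pdom psi x -> (\forall t \near x, pfwd psi t = pfwd phi t) ->
  \forall t \near pfwd phi x, pbwd psi t = pbwd phi t.
Proof.
move=> phiP psiP Dphi Dpsi E.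
have H1 : \forall t \near pfwd phi x, pfwd psi (pbwd phi t) = pfwd phi (pbwd phi t).
  exact: near_pbwd phiP Dphi E.
have H2 : \forall t \near pfwd phi x, pbwd psi (pfwd psi (pbwd phi t)) = pbwd phi t.
  exact: near_pbwd phiP Dphi (pfwdK_near psiP Dpsi).
have H3 := pbwdK_near phiP Dphi.
have H4 : \forall t \near pfwd phi x, pbwd psi (pfwd phi (pbwd phi t)) = pbwd phi t.
  by apply: filterS2 H1 H2 => t <-.
by apply: filterS2 H3 H4 => t ->.
Qed.

Lemma schwarzian_near (f g : R -> R) (x : R) : (\forall t \near x, f t = g t) ->
  schwarzian f x = schwarzian g x.
Proof.
move=> /near_derive1 E1; have E2 := near_derive1 E1.
have e1 : derive1 f x = derive1 g x := nbhs_singleton E1.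
have e2 : derive1 (derive1 f) x = derive1 (derive1 g) x := nbhs_singleton E2.
have E3 : \forall t \near x,
    derive1 (derive1 f) t / derive1 f t = derive1 (derive1 g) t / derive1 g t.
  by apply: filterS2 E1 E2 => t -> ->.
have e3 := nbhs_singleton (near_derive1 E3).
exact: (f_equal2 (fun u v => u - 2^-1 * v ^+ 2) e3 (f_equal2 (fun u v => u / v) e2 e1)).
Qed.

(** For r the quotient f''/f' of f = phi^-1, mu = y r with y constant along [d1], so y d_x mu - mu^2
    / 2 = y^2 (r' - r^2 / 2). *)
Lemma y_dx_mu_inv phi (q : plane) : local_diffeo phi -> prange phi q.1 ->
  y_dx (mu_inv phi) q - 2^-1 * mu_inv phi q ^+ 2 =
  q.2 ^+ 2 * schwarzian (pbwd phi) q.1.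
Proof.
move=> phiP Eq; have [_ _ _ bC _] := phiP.
have b0 : derive1 (pbwd phi) q.1 != 0.
  have [x Dx xq] := Eq; have := derive1_pbwd phiP Dx; rewrite xq.
  by apply: contra_eq_neq => ->; rewrite mul0r eq_sym oner_eq0.
have b1 := smooth_derivable1 (smooth_derive1 bC) Eq.
have b2 := smooth_derivable1 (smooth_derive1 (smooth_derive1 bC)) Eq.
have rd := is_deriveM b2 (is_deriveV b0 b1).
set r := (_ * _) in rd.
have {}rd : is_derive q.1 1 r (derive1 r q.1).
  by rewrite derive1E; apply: derivableP; case: rd.
have [_ yE] := is_deriveM (is_derive_snd q (d1 R)) (is_derive_fst (d1 R) rd).
have -> : y_dx (mu_inv phi) q = q.2 * (q.2 * derive1 r q.1).
  rewrite /y_dx; congr (_ * _).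
  rewrite [LHS]yE /= -![_ *: _]/(_ * _) mul1r mulr0 addr0.
  by [].
rewrite /schwarzian /mu_inv.
have alg (y d b : R) : y * (y * d) - 2^-1 * (y * b) ^+ 2 = y ^+ 2 * (d - 2^-1 * b ^+ 2).
  by field.
exact: alg.
Qed.

(** The action is computed with the chosen [arrow_rep]. Its inverse agrees with [pbwd phi] near the
    target, and the Schwarzian depends on the germ only. *)
Lemma delta2'E a phi p : Gamma phi -> lift_dom phi p ->
  let q := act_frame phi p in
  delta2' (H1_action Gamma) a (mk_arrow phi p) =
  (q.2 ^+ 2 * schwarzian (pbwd phi) q.1)%:C * a (mk_arrow phi p).
Proof.
move=> Gphi Up q; have phiP := dif Gphi; have [Dp p2] := Up.
have Gc := groupoid_mk_arrow Gphi Up.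
have tE : arrow_target (mk_arrow phi p) = q by exact: arrow_targetE.
have [psiP Dpsi psiE] := arrow_repP phiP Dp.
rewrite /delta2' /H1_action asboolT // tE.
set psi := arrow_rep _ in psiP Dpsi psiE *.
have Eq : prange psi q.1 by exists p.1 => //; rewrite (nbhs_singleton psiE).
have bE : \forall t \near q.1, pbwd psi t = pbwd phi t by exact: pbwd_near.
clearbody q psi; rewrite -(schwarzian_near bE) -y_dx_mu_inv //.
(* delta_n carries n - 1 iterations: one for delta_2 and none for delta_1. *)
rewrite [iter 2.-1 _ _ _]/(y_dx (mu_inv psi) q) [iter 1.-1 _ _ _]/(mu_inv psi q).
have alg (A B : R) (C : R[i]) : A%:C * C - 2^-1 * (B%:C * (B%:C * C)) =
    (A - 2^-1 * B ^+ 2)%:C * C.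
  have half : (2^-1 : R)%:C = 2^-1.
    by rewrite fmorphV; congr (_^-1); exact: (rmorph_nat (real_complex R) 2).
  by rewrite rmorphB rmorphM /= half expr2 rmorphM /= mulrBl !mulrA.
exact: alg.
Qed.

Lemma y_dx_iter_near0 k (f : plane -> R) (p : plane) : (\forall q \near p, f q = 0) ->
  \forall q \near p, iter k (@y_dx R) f q = 0.
Proof.
elim: k f => [//|k IH] f f0; rewrite iterSr; apply: IH.
move/nbhs_interior: f0; apply: filterS => q f0.
rewrite /y_dx (_ : 'D_ _ f q = 0) ?mulr0 //.
rewrite -(derive_cst (0 : R) q (d1 R)); apply: near_eq_derive.
exact: f0.
Qed.

(** The representative of a unit arrow is the identity near its base point, so [mu_inv] vanishes on
    a whole neighbourhood and all its iterated derivatives vanish too. *)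
Lemma Hdelta_unit_fun k w c : H1_action Gamma (Hdelta k) (unit_fun w) c = 0.
Proof.
rewrite /H1_action; case: asboolP => // Gc.
have [w0|/eqP/unit_fun_neq0[Hp cE]] := eqVneq (unit_fun w c) 0; first by rewrite w0 mulr0.
set p := c.1 in Hp cE.
have idP := local_diffeo_id GammaP.
rewrite cE arrow_targetE // act_frame_id.
have [psiP Dpsi psiE] := arrow_repP idP (I : pdom (pidentity R) p.1).
rewrite -/(unit_arrow p) in psiP Dpsi psiE *.
set psi := arrow_rep _ in psiP Dpsi psiE *.
have bE : \forall t \near p.1, pbwd psi t = id t.
  exact: (pbwd_near idP psiP I Dpsi psiE).
have b2 : \forall t \near p.1, derive1 (derive1 (pbwd psi)) t = 0.
  have := near_derive1 (near_derive1 bE); apply: filterS => t ->.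
  rewrite (_ : derive1 id = cst (1 : R)) ?derive1_cst //.
  by apply/funext => x; exact: derive1_id.
have m0 : \forall q \near p, mu_inv psi q = 0.
  have : \forall q \near p, derive1 (derive1 (pbwd psi)) q.1 = 0.
    have fstC : continuous (fst : plane -> R) by move=> x; exact: cvg_fst.
    exact: (fstC p _ b2).
  by apply: filterS => q; rewrite /mu_inv => ->; rewrite mul0r mulr0.
by rewrite (nbhs_singleton (y_dx_iter_near0 k.-1 m0)) mul0r.
Qed.

End Action.

(** * Test functions *)

Section TestFunctions.
Variable R : realType.
Local Notation plane := (R * R)%type.
Local Notation half_plane := (@half_plane R).
Implicit Types phi psi chi : partial_map R.

Lemma smooth_cover (U A B : set plane) (f : plane -> R) :
  U `<=` A `|` B -> smooth A f -> smooth B f -> smooth U f.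
Proof.
move=> UAB fA fB n; apply: Ck_local => p /UAB[Ap|Bp].
  by exists A; split=> //; exact: fA.
by exists B; split=> //; exact: fB.
Qed.

Lemma csmooth_cover (U A B : set plane) (f : plane -> R[i]) :
  U `<=` A `|` B -> csmooth A f -> csmooth B f -> csmooth U f.
Proof. by move=> UAB [? ?] [? ?]; split; apply: smooth_cover UAB _ _. Qed.

Lemma eq_smooth (U : set plane) (f g : plane -> R) : open U ->
  {in U, f =1 g} -> smooth U f -> smooth U g.
Proof. by move=> oU fg fC n; exact: eq_Ck oU fg (fC n). Qed.

Lemma eq_csmooth (U : set plane) (f g : plane -> R[i]) : open U ->
  {in U, f =1 g} -> csmooth U f -> csmooth U g.
Proof.
move=> oU fg [fR fI]; split; [apply: eq_smooth oU _ fR|apply: eq_smooth oU _ fI];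
  by move=> p Up; rewrite fg.
Qed.

Lemma sub_csmooth (A B : set plane) (f : plane -> R[i]) : A `<=` B ->
  csmooth B f -> csmooth A f.
Proof.
by move=> AB [fR fI]; split=> n; [exact: sub_Ck AB (fR n)|exact: sub_Ck AB (fI n)].
Qed.

Lemma csmooth0 (U : set plane) : csmooth U (fun=> 0).
Proof. by split=> n; exact: Ck_cst. Qed.

Lemma csmoothD (U : set plane) (f g : plane -> R[i]) : open U ->
  csmooth U f -> csmooth U g -> csmooth U (fun p => f p + g p).
Proof.
move=> oU [fR fI] [gR gI]; split.
  apply: eq_smooth oU _ (fun n => CkD oU (fR n) (gR n)) => p _ /=.
  by case: (f p) => ? ?; case: (g p).
apply: eq_smooth oU _ (fun n => CkD oU (fI n) (gI n)) => p _ /=.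
by case: (f p) => ? ?; case: (g p).
Qed.

Lemma csmooth_sum (U : set plane) n (f : 'I_n -> plane -> R[i]) : open U ->
  (forall i, csmooth U (f i)) -> csmooth U (fun p => \sum_(i < n) f i p).
Proof.
move=> oU; elim: n f => [|n IH] f fC.
  by apply: eq_csmooth oU _ (csmooth0 U) => p _; rewrite big_ord0.
apply: eq_csmooth oU _ (csmoothD oU (fC ord0) (IH _ (fun i => fC (lift ord0 i)))).
by move=> p _; rewrite big_ord_recl.
Qed.

Lemma csmoothMl (U : set plane) (w : plane -> R) (f : plane -> R[i]) : open U ->
  smooth U w -> csmooth U f -> csmooth U (fun p => (w p)%:C * f p).
Proof.
move=> oU wC [fR fI]; split.
  apply: eq_smooth oU _ (fun n => CkM oU (wC n) (fR n)) => p _ /=.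
  by case: (f p) => a b /=; rewrite mul0r subr0.
apply: eq_smooth oU _ (fun n => CkM oU (wC n) (fI n)) => p _ /=.
by case: (f p) => a b /=; rewrite mul0r addr0.
Qed.

Lemma smooth_act_frame phi (g : plane -> R) : local_diffeo phi ->
  smooth half_plane g -> smooth (lift_dom phi) (fun p => g (act_frame phi p)).
Proof.
move=> phiP gC n; case: (phiP) => -[oD _] _ fC _ _.
have oU := open_lift_dom oD.
apply: Ck_comp2 oU _ (gC n) _ _.
- by move=> p Up; exact: lift_dom_act.
- exact: (smooth_fst_comp phiP fC n).
- have aC := smooth_fst_comp phiP (smooth_derive1 fC) n.
  exact: (CkM (open_lift_dom oD) aC (@Ck_snd R R R n (lift_dom phi))).
Qed.

Lemma csmooth_act_frame phi (f : plane -> R[i]) : local_diffeo phi ->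
  csmooth half_plane f -> csmooth (lift_dom phi) (fun p => f (act_frame phi p)).
Proof.
move=> phiP [fR fI]; split; first exact: smooth_act_frame phiP fR.
exact: smooth_act_frame phiP fI.
Qed.

Lemma not_closure_support (f : plane -> R[i]) p :
  ~ closure [set q | f q != 0] p -> f p = 0.
Proof. by move=> H; apply: contrapT => /eqP f0; apply: H; exact: subset_closure. Qed.

Lemma test_function_mul (U : set plane) (h f g : plane -> R[i]) :
  test_function U f -> (forall p, g p = h p * f p) -> csmooth half_plane g ->
  test_function U g.
Proof.
move=> [_ fc fU] gE gC.
have gf : closure [set q | g q != 0] `<=` closure [set q | f q != 0].
  by apply: closureS => q /=; apply: contraNN => /eqP f0; rewrite gE f0 mulr0.
split=> //; last exact: subset_trans fU.
by apply: subclosed_compact fc gf; exact: closed_closure.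
Qed.

Lemma test_functionMl (U : set plane) (w : plane -> R) f :
  smooth half_plane w -> test_function U f -> test_function U (fun p => (w p)%:C * f p).
Proof.
move=> wC fT; apply: (test_function_mul fT) => //.
by case: fT => fC _ _; apply: csmoothMl => //; exact: open_half_plane.
Qed.

Lemma local_diffeo_inv phi : local_diffeo phi -> local_diffeo (pinverse phi).
Proof.
move=> phiP; case: (phiP) => -[oD oE] bK fC bC a0.
have rE : prange (pinverse phi) = pdom phi.
  apply/seteqP; split=> [_ [_ [x Dx <-] <-]|x Dx] /=; first by rewrite bK.
  by exists (pfwd phi x); [exists x|exact: bK].
split; rewrite ?rE //.
  by move=> _ [x Dx <-] /=; rewrite bK.
move=> _ [x Dx <-] /=; have := derive1_pbwd phiP Dx.
have := derive1_pfwd_gt0 phiP Dx; set a := derive1 _ _; set b := derive1 _ _ => ag ab.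
by rewrite -(pmulr_lgt0 _ ag) ab.
Qed.

(** The factor w o phi^-1 is controlled only on the image of [phi]. That image and the complement of
    the support of [f] cover the half plane, and on the latter the product is 0. *)
Lemma test_functionMact phi (w : plane -> R) f : local_diffeo phi ->
  smooth half_plane w -> test_function (act_frame phi @` lift_dom phi) f ->
  test_function (act_frame phi @` lift_dom phi)
    (fun q => (w (act_frame (pinverse phi) q))%:C * f q).
Proof.
move=> phiP wC fT; apply: (test_function_mul fT) => //.
have phiP' := local_diffeo_inv phiP.
have oV : open (lift_dom (pinverse phi)).
  by apply: open_lift_dom; case: phiP' => -[].
case: fT => fC fc; rewrite image_act // => fV.
set K := closure _ in fc fV.
have oK : open (~` K) by apply/closed_openC/closed_closure.
apply: (@csmooth_cover _ (lift_dom (pinverse phi)) (~` K)).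
- by move=> p _; have [Kp|] := pselect (K p); [left; exact: fV|right].
- apply: csmoothMl => //; first exact: smooth_act_frame.
  by apply: sub_csmooth fC => q [].
- apply: eq_csmooth oK _ (csmooth0 _) => q; rewrite inE => Kq.
  by rewrite (not_closure_support Kq) mulr0.
Qed.

Definition pullback phi (f : plane -> R[i]) (p : plane) : R[i] :=
  if `[< lift_dom phi p >] then f (act_frame phi p) else 0.

(** Compactness of the support is what makes the extension by zero smooth across the boundary of
    [lift_dom phi]. *)
Lemma csmooth_pullback phi f : local_diffeo phi ->
  test_function (act_frame phi @` lift_dom phi) f ->
  csmooth half_plane (pullback phi f).
Proof.
move=> phiP; rewrite image_act // => -[fC fc fV].
have phiP' := local_diffeo_inv phiP.
have oU : open (lift_dom phi) by apply: open_lift_dom; case: (phiP) => -[].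
set K := closure _ in fc fV.
(* The preimage of the support under [phi] is compact, hence closed in the whole plane, so its
   complement is an open set where the pullback vanishes. *)
pose K' := act_frame (pinverse phi) @` K.
have cK' : closed K'.
  apply: compact_closed; first exact: norm_hausdorff.
  apply: continuous_compact fc; apply: continuous_in_subspaceT => q.
  rewrite inE => /fV Vq.
  have C (g : plane -> R) : smooth setT g ->
      {for q, continuous (fun q => g (act_frame (pinverse phi) q))}.
    move=> gC; have gC' : smooth half_plane g by move=> n; exact: sub_Ck (gC n).
    exact: (smooth_act_frame phiP' gC' 0) Vq.
  have C1 := C _ (fun n => @Ck_fst R R R n setT).
  have C2 := C _ (fun n => @Ck_snd R R R n setT).
  exact: (cvg_pair C1 C2).
apply: (@csmooth_cover _ (lift_dom phi) (~` K')).
- move=> p _; have [[q Kq <-]|] := pselect (K' p); [left|by right].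
  have [p' Up' <-] := lift_dom_invP phiP (fV _ Kq).
  by rewrite act_frameK.
- apply: eq_csmooth oU _ (csmooth_act_frame phiP fC) => p; rewrite inE => Up.
  by rewrite /pullback asboolT.
- apply: eq_csmooth (closed_openC cK') _ (csmooth0 _) => p; rewrite inE => K'p.
  rewrite /pullback; case: asboolP => // Up; rewrite not_closure_support // => Kp.
  by apply: K'p; exists (act_frame phi p) => //; exact: act_frameK.
Qed.

Lemma exists_test_function (U : set plane) p : U `<=` half_plane -> nbhs p U ->
  exists g : plane -> R, [/\ smooth half_plane g, g p != 0,
    test_function U (fun q => (g q)%:C) & forall q, g q != 0 -> U q].
Proof.
move=> UH /exists_bump[g [gC gp gc gU]]; exists g; split=> //.
- by move=> n; exact: sub_Ck (gC n).
- have gE : [set q | (g q)%:C != 0] = [set q | g q != 0].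
    by apply/seteqP; split=> q /=; rewrite (inj_eq (@complexI R) _ 0).
  split; rewrite ?gE //; split=> n; first exact: sub_Ck (gC n).
  exact: Ck_cst.
- by move=> q gq; apply: gU; exact: subset_closure.
Qed.

End TestFunctions.

(** * Projective actions *)

Section Projective.
Variable R : realType.
Local Notation plane := (R * R)%type.
Local Notation half_plane := (@half_plane R).
Implicit Types phi psi chi : partial_map R.
Variable Gamma : set (partial_map R).
Hypothesis GammaP : pseudogroup Gamma.

Let dif phi : Gamma phi -> local_diffeo phi. Proof. exact: pseudogroup_diffeo. Qed.
Let Gid : Gamma (pidentity R). Proof. exact: pseudogroup_id. Qed.

Lemma arrow_act phi psi (p : plane) : Gamma phi -> lift_dom phi p ->
  mk_arrow phi p = mk_arrow psi p -> act_frame phi p = act_frame psi p.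
Proof.
by move=> Gphi [Dp _] /(mk_arrow_inj (dif Gphi) Dp)[_]; exact: act_frame_near.
Qed.

Lemma fUMl (w : plane -> R[i]) f phi psi p : Gamma psi -> lift_dom psi p ->
  fU (fun q => w q * f q) phi (mk_arrow psi p) =
  w (act_frame psi p) * fU f phi (mk_arrow psi p).
Proof.
move=> Gpsi Up; rewrite /fU; case: asboolP => [[Up' E]|_]; last by rewrite mulr0.
by rewrite (arrow_act Gpsi Up E).
Qed.

Lemma fUMr (w : plane -> R[i]) f phi psi p : Gamma phi -> Gamma psi -> lift_dom psi p ->
  fU (fun q => w (act_frame (pinverse phi) q) * f q) phi (mk_arrow psi p) =
  fU f phi (mk_arrow psi p) * w p.
Proof.
move=> Gphi Gpsi Up; rewrite /fU; case: asboolP => [[Up' E]|_]; last by rewrite mul0r.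
by rewrite mulrC act_frameK //; exact: dif.
Qed.

(** On f U_phi, left multiplication replaces f by w f and right multiplication by (w o phi^-1) f;
    both are again test functions on the image of [phi]. *)
Lemma multiplier_unit_fun (w : plane -> R) : smooth half_plane w ->
  multiplier Gamma (unit_fun (fun p => (w p)%:C)).
Proof.
move=> wC; split=> [c nc|_ [n [f [phi [fP ->]]]]].
  apply: contrapT => /unit_fun_neq0[Hp E]; apply: nc; rewrite E.
  exact: groupoid_mk_arrow Gid _.
split.
  exists n, (fun i q => (w q)%:C * f i q), phi; split=> [i|].
    by have [Gi fT] := fP i; split=> //; exact: test_functionMl.
  apply/funext => c; have [/groupoidP[psi [Gpsi Up ->]]|nc] := pselect (groupoid Gamma c).
    rewrite unit_fun_convol // mulr_sumr; apply: eq_bigr => i _.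
    by rewrite (fUMl (fun q => (w q)%:C)).
  rewrite convol_out // big1 // => i _.
  by have [Gi _] := fP i; apply: contrapT => /(fU_groupoid Gi)/nc.
exists n, (fun i q => (w (act_frame (pinverse (phi i)) q))%:C * f i q), phi; split=> [i|].
  by have [Gi fT] := fP i; split=> //; exact: test_functionMact (dif Gi) wC fT.
apply/funext => c; have [/groupoidP[psi [Gpsi Up ->]]|nc] := pselect (groupoid Gamma c).
  rewrite convol_unit_fun // mulr_suml; apply: eq_bigr => i _.
  by have [Gi _] := fP i; rewrite (fUMr (fun q => (w q)%:C)).
rewrite convol_out // big1 // => i _.
by have [Gi _] := fP i; apply: contrapT => /(fU_groupoid Gi)/nc.
Qed.

Lemma cocycle_projective (w : plane -> R) : smooth half_plane w ->
  schwarzian_cocycle Gamma w -> projective Gamma (H1_action Gamma).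
Proof.
move=> wC wP; exists (unit_fun (fun p => (- w p)%:C)); split.
- apply: multiplier_unit_fun => n.
  have oH := @open_half_plane R.
  apply: (@eq_Ck _ _ _ _ _ (cst (-1) \* w)) => //.
    by move=> p _; exact: mulN1r.
  by apply: CkM => //; exact: Ck_cst.
- move=> a _ c; have [/groupoidP[phi [Gphi Up ->]]|nc] := pselect (groupoid Gamma c).
    rewrite delta2'E // unit_fun_convol // convol_unit_fun //.
    (* The cocycle identity for phi^-1 at the target q reads w(p) = w(q) + y^2 S(phi^-1), which
       explains the sign of the implementing multiplier. *)
    have := wP _ (pseudogroup_inv GammaP Gphi) _ (lift_dom_inv (dif Gphi) Up).
    rewrite act_frameK /=; [move=> ->|exact: dif|by []].
    set u := w _; set v := _ * schwarzian _ _.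
    by rewrite [X in _ - X]mulrC -mulrBl -rmorphB; congr (_%:C * _); ring.
  rewrite !convol_out // subrr /delta2' /H1_action asboolF //.
  by rewrite mulr0 subrr.
- by move=> k _ c; exact: Hdelta_unit_fun.
Qed.

(** * From an implementing multiplier to a cocycle *)

Section Converse.
Variable Omega : gfun R.
Hypothesis OmegaM : multiplier Gamma Omega.
Hypothesis OmegaC : forall a, galgebra Gamma a -> forall c,
  delta2' (H1_action Gamma) a c = convol Gamma Omega a c - convol Gamma a Omega c.

Lemma galgebra_fU f phi : Gamma phi ->
  test_function (act_frame phi @` lift_dom phi) f -> galgebra Gamma (fU f phi).
Proof.
move=> Gphi fT; exists 1%N, (fun=> f), (fun=> phi); split=> //.
by apply/funext => c; rewrite big_ord1.
Qed.

Lemma test_function_id (U : set plane) f : U `<=` half_plane -> test_function U f ->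
  test_function (act_frame (pidentity R) @` lift_dom (pidentity R)) f.
Proof.
move=> UH [fC fc fU]; split=> // p /fU/UH Hp.
by exists p; [exact: lift_dom_id|exact: act_frame_id].
Qed.

(* Commuting with f in C_c(M) forces Omega to live on the arrows whose
   source and target agree. *)
Lemma Omega_isotropic chi p : Gamma chi -> lift_dom chi p ->
  Omega (mk_arrow chi p) <> 0 -> act_frame chi p = p.
Proof.
move=> Gchi Up O0; apply: contrapT => qp; set q := act_frame chi p in qp.
have Hp : half_plane p by case: Up.
have oU : open (half_plane `&` ~` [set q]).
  apply: openI; first exact: open_half_plane.
  apply: closed_openC; apply: compact_closed; last exact: compact_set1.
  exact: norm_hausdorff.
have Np : nbhs p (half_plane `&` ~` [set q]).
  by apply: open_nbhs_nbhs; split=> //; split=> //= /esym.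
have [g [gC gp gT gU]] := exists_test_function (@subIsetl _ _ _) Np.
have gq : g q = 0 by apply: contrapT => /eqP/gU[_]; apply.
have gA := galgebra_fU Gid (test_function_id (@subIsetl _ _ _) gT).
have := OmegaC gA (mk_arrow chi p).
rewrite delta2'E //.
(* An arrow with the germ of the identity would have target p, against q <> p. *)
have -> : fU (fun q => (g q)%:C) (pidentity R) (mk_arrow chi p) = 0.
  apply: contrapT => /fU_neq0[/= _ E]; apply: qp.
  by rewrite /q (arrow_act Gchi Up E) act_frame_id.
have E1 : mk_arrow chi p = mk_arrow (pcompose chi (pidentity R)) p.
  by apply: mk_arrow_near; exact: near_refl.
have E2 : mk_arrow chi p = mk_arrow (pcompose (pidentity R) chi) p.
  by apply: mk_arrow_near; exact: near_refl.
have Uq : lift_dom (pidentity R) q by split=> //; exact: lift_dom_act (dif Gchi) Up.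
have C1 : convol Gamma Omega (fU (fun q => (g q)%:C) (pidentity R)) (mk_arrow chi p) =
    Omega (mk_arrow chi p) * (g p)%:C.
  by rewrite {1}E1 convol_fU // act_frame_id.
have C2 : convol Gamma (fU (fun q => (g q)%:C) (pidentity R)) Omega (mk_arrow chi p) = 0.
  by rewrite E2 fU_convol // act_frame_id -/q gq mul0r.
rewrite C1 C2 subr0 mulr0 => /esym/eqP.
rewrite mulf_eq0 => /orP[/eqP//|].
by rewrite (inj_eq (@complexI R) _ 0) (negbTE gp).
Qed.

Definition arrows_from (p : plane) : set (arrow R) :=
  [set c | groupoid Gamma c /\ c.1 = p].

(** The product of [Omega] with a bump on the units belongs to the algebra, and convolving from the
    right by this bump multiplies [Omega] by its value at the source. *)
Lemma Omega_local p0 : half_plane p0 -> exists (g : plane -> R) n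
    (f : 'I_n -> plane -> R[i]) (phi : 'I_n -> partial_map R),
  [/\ smooth half_plane g, g p0 != 0,
      forall i, Gamma (phi i) /\
        test_function (act_frame (phi i) @` lift_dom (phi i)) (f i)
    & forall c, groupoid Gamma c ->
        Omega c * (g c.1)%:C = \sum_(i < n) fU (f i) (phi i) c].
Proof.
move=> Hp; have Np : nbhs p0 half_plane.
  by apply: open_nbhs_nbhs; split=> //; exact: open_half_plane.
have [g [gC gp gT gU]] := exists_test_function (@subset_refl _ _) Np.
have gA := galgebra_fU Gid (test_function_id (@subset_refl _ _) gT).
have [[n [f [phi [fP E]]]] _] := OmegaM.2 _ gA.
exists g, n, f, phi; split=> // c /groupoidP[chi [Gchi]].
move: (c.1) => p Up ->.
rewrite -(congr1 (fun h : gfun R => h (mk_arrow chi p)) E) /=.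
have E1 : mk_arrow chi p = mk_arrow (pcompose chi (pidentity R)) p.
  by apply: mk_arrow_near; exact: near_refl.
rewrite [in RHS]E1 convol_fU // ?act_frame_id //.
by apply: lift_dom_id; case: Up.
Qed.

(** Over a single source the local expression of [Omega] meets at most one arrow for each
    [phi i]. *)
Lemma Omega_finite p : half_plane p ->
  finite_set (arrows_from p `&` [set c | Omega c != 0]).
Proof.
move=> Hp; have [g [n [f [phi [gC gp fP E]]]]] := Omega_local Hp.
apply: (@sub_finite_set _ _ [set mk_arrow (phi i) p | i in [set: 'I_n]]); last first.
  by apply: finite_image; exact: finite_finset.
move=> c [[Gc cp] /= O0]; apply: contrapT => nc.
have := E c Gc; rewrite cp big1 => [/eqP|i _].
  by rewrite mulf_eq0 (negbTE O0) (inj_eq (@complexI R) _ 0) (negbTE gp).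
apply: contrapT => /fU_neq0[_ cE]; apply: nc; exists i => //.
by rewrite -cp -cE.
Qed.

(* Summing over all arrows with a given source is smooth even when the
   groupoid is not Hausdorff, unlike restricting Omega to the units. *)
Definition source_sum (p : plane) : R[i] := \sum_(c \in arrows_from p) Omega c.

Lemma csmooth_source_sum : csmooth half_plane source_sum.
Proof.
have main p0 : half_plane p0 -> exists N, [/\ N p0 & csmooth N source_sum].
  move=> Hp0; have [g [n [f [phi [gC gp fP E]]]]] := Omega_local Hp0.
  have sumE p : source_sum p * (g p)%:C = \sum_(i < n) pullback (phi i) (f i) p.
    rewrite /source_sum mulr_fsuml.
    rewrite (@eq_fsbigr _ _ _ _ _ (fun c => \sum_(i < n) fU (f i) (phi i) c)); last first.
      by move=> c; rewrite inE => -[Gc <-]; exact: E.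
    (* Different indices may give the same arrow, so the sum runs over the set [D] of arrows; after
       exchanging the sums, index i contributes at its own arrow only, with value
       [pullback (phi i) (f i) p]. *)
    pose D := [set mk_arrow (phi i) p | i in [set i : 'I_n | lift_dom (phi i) p]].
    have fD : finite_set D by apply: finite_image; exact: finite_finset.
    rewrite -(@fsbig_widen _ _ _ _ D); first last.
    - move=> c [[Gc cp] nD]; apply: big1 => i _.
      apply: contrapT => /fU_neq0[Ui cE]; apply: nD; exists i.
        by rewrite /= -cp.
      by rewrite -cp -cE.
    - by move=> _ [i Ui <-]; split=> //; apply: groupoid_mk_arrow; [case: (fP i)|].
    rewrite fsbig_finite // exchange_big; apply: eq_bigr => i _.
    rewrite -fsbig_finite // /pullback; case: asboolP => Ui.
      rewrite (fsbig_single (x := mk_arrow (phi i) p)); last 2 first.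
      - by exists i.
      - move=> _ [j Uj <-] ne; apply: contrapT => /fU_neq0[_ /= ji].
        exact: ne.
      by rewrite fU_mk.
    apply: fsbig1 => _ [j Uj <-]; apply: contrapT => /fU_neq0[/=].
    by [].
  pose N := half_plane `&` [set p | g p != 0].
  have oN : open N.
    rewrite openE => p [Hp gp'].
    have gc : {for p, continuous g} := gC 0%N p Hp.
    have N1 : nbhs p half_plane.
      by apply: open_nbhs_nbhs; split=> //; exact: open_half_plane.
    have N2 : nbhs p [set p | g p != 0].
      exact: cvgr_neq0 gc gp'.
    by apply: filterI.
  exists N; split=> //.
  have sC : csmooth N (fun p => \sum_(i < n) pullback (phi i) (f i) p).
    apply: csmooth_sum => // i; apply: (@sub_csmooth _ _ half_plane) => [p []//|].
    by have [Gi fT] := fP i; exact: csmooth_pullback (dif Gi) fT.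
  have giC : smooth N (fun p => (g p)^-1).
    by move=> k; apply: CkV => // [p []|] //; apply: sub_Ck (gC k) => p [].
  apply: eq_csmooth oN _ (csmoothMl oN giC sC) => p; rewrite inE => -[Hp gp'].
  by rewrite -sumE mulrC -mulrA -rmorphM mulfV // mulr1.
split=> n; apply: Ck_local => p /main[N [Np [NR NI]]]; exists N; split=> //.
Qed.

(** The stabilizer of a point of the frame bundle, as germs: chi fixes p.1 and has derivative 1
    there. *)
Definition isotropy (p : plane) : set (arrow R) :=
  [set c | exists chi, [/\ Gamma chi, lift_dom chi p, act_frame chi p = p
                         & c = mk_arrow chi p]].

Lemma source_sumE p : source_sum p = \sum_(c \in isotropy p) Omega c.
Proof.
apply/esym/fsbig_widen => [_ [chi [Gchi Up _ ->]]|c [[Gc cp] nI]].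
  by split=> //; exact: groupoid_mk_arrow.
apply: contrapT => O0; apply: nI; have [chi [Gchi Up E]] := groupoidP Gc.
rewrite cp in Up E; exists chi; split=> //.
by apply: Omega_isotropic => //; rewrite -E.
Qed.

(** A total function of arrows, as reindexing requires, at the price of a chosen representative;
    [conj_arrowE] shows that any representative in [Gamma] gives the same arrow. *)
Definition conj_arrow phi (q : plane) (c : arrow R) : arrow R :=
  mk_arrow (pcompose phi (pcompose (arrow_rep c) (pinverse phi))) q.

Lemma conj_arrowE phi chi p : Gamma phi -> Gamma chi ->
  lift_dom phi p -> lift_dom chi p ->
  conj_arrow phi (act_frame phi p) (mk_arrow chi p) =
  mk_arrow (pcompose phi (pcompose chi (pinverse phi))) (act_frame phi p).
Proof.
move=> Gphi Gchi [Dp _] [Dchi _]; apply: mk_arrow_near.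
have [_ _ E] := arrow_repP (dif Gchi) Dchi.
have E' : \forall t \near pfwd phi p.1,
    pfwd (arrow_rep (mk_arrow chi p)) (pbwd phi t) = pfwd chi (pbwd phi t).
  exact: near_pbwd (dif Gphi) Dp E.
by apply: filterS E' => t /= ->.
Qed.

Lemma conjP phi chi p (q := act_frame phi p)
    (psi := pcompose phi (pcompose chi (pinverse phi))) :
  Gamma phi -> Gamma chi -> lift_dom phi p -> lift_dom chi p ->
  act_frame chi p = p ->
  [/\ Gamma psi, lift_dom psi q & act_frame psi q = q].
Proof.
move=> Gphi Gchi Up Uchi chip.
have Ginv := pseudogroup_inv GammaP Gphi.
have Gc := pseudogroup_comp GammaP Gchi Ginv.
have Uq := lift_dom_inv (dif Gphi) Up.
have qp := act_frameK (dif Gphi) Up.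
have Uchi' : lift_dom chi (act_frame (pinverse phi) q) by rewrite qp.
have Uc := lift_dom_comp Uq Uchi'.
have cE : act_frame (pcompose chi (pinverse phi)) q = p.
  by rewrite act_frame_comp //; [rewrite qp|exact: dif|exact: dif].
have Up' : lift_dom phi (act_frame (pcompose chi (pinverse phi)) q) by rewrite cE.
split; first exact: pseudogroup_comp.
  exact: lift_dom_comp.
by rewrite act_frame_comp ?cE //; exact: dif.
Qed.

Lemma conj_isotropy phi p c : Gamma phi -> lift_dom phi p -> isotropy p c ->
  isotropy (act_frame phi p) (conj_arrow phi (act_frame phi p) c).
Proof.
move=> Gphi Up [chi [Gchi Uchi chip ->]]; rewrite conj_arrowE //.
have [Gpsi Upsi psiq] := conjP Gphi Gchi Up Uchi chip.
by eexists; split; [exact: Gpsi|exact: Upsi|exact: psiq|].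
Qed.

Lemma conj_arrowK phi p c : Gamma phi -> lift_dom phi p -> isotropy p c ->
  conj_arrow (pinverse phi) p (conj_arrow phi (act_frame phi p) c) = c.
Proof.
move=> Gphi Up [chi [Gchi Uchi chip ->]]; rewrite conj_arrowE //.
have [Gpsi Upsi psiq] := conjP Gphi Gchi Up Uchi chip.
have := conj_arrowE (pseudogroup_inv GammaP Gphi) Gpsi
  (lift_dom_inv (dif Gphi) Up) Upsi.
rewrite act_frameK; [move=> ->|exact: dif|by []].
have [Dp _] := Up; have [Dchi _] := Uchi.
have chip1 : pfwd chi p.1 = p.1 by rewrite -{2}chip.
apply: mk_arrow_near.
have K1 := pfwdK_near (dif Gphi) Dp.
have K2 : \forall t \near p.1, pbwd phi (pfwd phi (pfwd chi t)) = pfwd chi t.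
  apply: (near_pfwd (P := fun t => pbwd phi (pfwd phi t) = t) (dif Gchi) Dchi).
  by rewrite chip1; exact: K1.
by apply: filterS2 K1 K2 => t /= ->.
Qed.

Lemma conj_bij phi p : Gamma phi -> lift_dom phi p ->
  set_bij (isotropy p) (isotropy (act_frame phi p)) (conj_arrow phi (act_frame phi p)).
Proof.
move=> Gphi Up; have Ginv := pseudogroup_inv GammaP Gphi.
have Uq := lift_dom_inv (dif Gphi) Up.
have qp := act_frameK (dif Gphi) Up.
split; first by move=> c; exact: conj_isotropy.
  move=> c c'; rewrite !inE => Ic Ic' E.
  by rewrite -(conj_arrowK Gphi Up Ic) E conj_arrowK.
move=> c Ic; have := conj_isotropy Ginv Uq Ic; rewrite qp => Ic'.
exists (conj_arrow (pinverse phi) p c) => //.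
by have := conj_arrowK Ginv Uq Ic; rewrite qp.
Qed.

Lemma Omega_conj phi p c (q := act_frame phi p) :
  Gamma phi -> lift_dom phi p -> isotropy p c ->
  Omega (conj_arrow phi q c) = Omega c +
    (if c == unit_arrow p then (q.2 ^+ 2 * schwarzian (pbwd phi) q.1)%:C else 0).
Proof.
move=> Gphi Up [chi [Gchi Uchi chip ->]]; rewrite conj_arrowE //.
have [Gpsi Upsi psiq] := conjP Gphi Gchi Up Uchi chip.
set psi := pcompose _ _ in Gpsi Upsi psiq *; rewrite -/q in Upsi psiq *.
have Uq : lift_dom (pinverse phi) q := lift_dom_inv (dif Gphi) Up.
have [Dp p2] := Up; have [Dchi _] := Uchi.
have oV : open (lift_dom (pinverse phi)).
  by apply: open_lift_dom; case: (dif (pseudogroup_inv GammaP Gphi)) => -[].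
have VH : lift_dom (pinverse phi) `<=` half_plane by move=> ? [].
have [g [gC gq gT gU]] := exists_test_function VH (open_nbhs_nbhs (conj oV Uq)).
have gA : galgebra Gamma (fU (fun q => (g q)%:C) phi).
  by apply: galgebra_fU => //; rewrite image_act //; exact: dif.
have Up' : lift_dom phi (act_frame chi p) by rewrite chip.
have Gpc := pseudogroup_comp GammaP Gphi Gchi.
have Upc := lift_dom_comp Uchi Up'.
have K1 := pfwdK_near (dif Gphi) Dp.
have := OmegaC gA (mk_arrow (pcompose phi chi) p).
rewrite fU_convol // chip -/q.
have -> : convol Gamma Omega (fU (fun q => (g q)%:C) phi)
    (mk_arrow (pcompose phi chi) p) = Omega (mk_arrow psi q) * (g q)%:C.
  (* Since psi = phi chi phi^-1, the same arrow factors as psi after phi, which lets [convol_fU]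
     isolate [Omega] at psi. *)
  have -> : mk_arrow (pcompose phi chi) p = mk_arrow (pcompose psi phi) p.
    by apply: mk_arrow_near; apply: filterS K1 => t /= ->.
  by rewrite convol_fU.
have gqC : (g q)%:C != 0 by rewrite (inj_eq (@complexI R) _ 0).
case: eqVneq => [cE|ne].
  have idE : \forall t \near p.1, pfwd chi t = t.
    by have [_] := mk_arrow_inj (dif Gchi) Dchi cE.
  have -> : mk_arrow (pcompose phi chi) p = mk_arrow phi p.
    by apply: mk_arrow_near; apply: filterS idE => t /= ->.
  rewrite delta2'E // fU_mk // -/q => /eqP.
  rewrite -subr_eq0 [_ * Omega _]mulrC -mulrBl -mulrBl mulf_eq0 (negbTE gqC) orbF.
  by rewrite subr_eq0 => /eqP ->; rewrite addrC subrK.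
rewrite delta2'E //.
(* If phi chi had the germ of phi at p, cancelling [phi] on the left would make chi a unit. *)
have -> : fU (fun q => (g q)%:C) phi (mk_arrow (pcompose phi chi) p) = 0.
  apply: contrapT => /fU_neq0[/= _ E]; move/eqP: ne; apply.
  apply: mk_arrow_near.
  have [_ nE] := mk_arrow_inj (dif Gpc) Upc.1 E.
  have chip1 : pfwd chi p.1 = p.1 by rewrite -{2}chip.
  have K2 : \forall t \near p.1, pbwd phi (pfwd phi (pfwd chi t)) = pfwd chi t.
    apply: (near_pfwd (P := fun t => pbwd phi (pfwd phi t) = t) (dif Gchi) Dchi).
    by rewrite chip1; exact: K1.
  have K3 : \forall t \near p.1, pbwd phi (pfwd phi (pfwd chi t)) = t.
    by apply: filterS2 nE K1 => t /= ->.
  by apply: filterS2 K2 K3 => t e2 e3; exact: etrans (esym e2) e3.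
rewrite mulr0 [_ * Omega _]mulrC -mulrBl => /esym/eqP.
by rewrite mulf_eq0 (negbTE gqC) orbF subr_eq0 addr0 => /eqP.
Qed.

Lemma source_sum_act phi p (q := act_frame phi p) : Gamma phi -> lift_dom phi p ->
  source_sum q = source_sum p + (q.2 ^+ 2 * schwarzian (pbwd phi) q.1)%:C.
Proof.
move=> Gphi Up; set s := (_ * _)%:C; have Hp : half_plane p by case: Up.
rewrite !source_sumE [LHS](reindex_fsbig _ _ _ _ (conj_bij Gphi Up)) -/q.
rewrite (@eq_fsbigr _ _ _ _ _
  (fun c => Omega c + (if c == unit_arrow p then s else 0))); last first.
  by move=> c; rewrite inE => Ic; exact: Omega_conj.
(* The unit arrow is added to the support of [Omega] because the shift sits there even when [Omega]
   vanishes at the unit. *)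
pose D := (isotropy p `&` [set c | Omega c != 0]) `|` [set unit_arrow p].
have Iu : isotropy p (unit_arrow p).
  by exists (pidentity R); split=> //; exact: act_frame_id.
have fD : finite_set D.
  rewrite finite_setU; split; last exact: finite_set1.
  apply: sub_finite_set (Omega_finite Hp) => _ [[chi [Gchi Uchi _ ->]] O0].
  by split=> //; split=> //; exact: groupoid_mk_arrow.
have DI : D `<=` isotropy p by move=> c [[]|->].
have out c : (isotropy p `\` D) c -> Omega c = 0 /\ c != unit_arrow p.
  move=> [Ic nD]; split; last by apply/eqP => cE; apply: nD; right.
  by apply: contrapT => /eqP O0; apply: nD; left.
rewrite -(@fsbig_widen _ _ _ _ D) // => [|c /out[/= -> /negbTE ->]]; last exact: addr0.
rewrite -(@fsbig_widen _ _ _ _ D (isotropy p) Omega) // => [|c /out[]//].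
have Du : D (unit_arrow p) by right.
rewrite fsbig_split //; congr (_ + _).
rewrite (fsbig_single Du) ?eqxx // => c _ /eqP/negbTE cu.
by rewrite ifF.
Qed.

Lemma projective_cocycle :
  exists w, smooth half_plane w /\ schwarzian_cocycle Gamma w.
Proof.
exists (fun p => - complex.Re (source_sum p)); split.
  have oH := @open_half_plane R; move=> n.
  apply: (@eq_Ck _ _ _ _ _ (cst (-1) \* (fun p => complex.Re (source_sum p)))) => //.
    by move=> p _; exact: mulN1r.
  by apply: CkM => //; [exact: Ck_cst|have [sR _] := csmooth_source_sum; exact: sR].
(* [source_sum_act] involves the Schwarzian of the inverse at the target; applied to phi^-1 at
   phi(p) it involves that of [phi] at p, and the minus sign in w restores the direction of the
   cocycle. *)
move=> phi Gphi p Up; have Ginv := pseudogroup_inv GammaP Gphi.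
have Uq := lift_dom_inv (dif Gphi) Up.
have := source_sum_act Ginv Uq; rewrite act_frameK //; last exact: dif.
move=> ->; set z := source_sum _; case: z => a b /=.
by rewrite opprD subrK.
Qed.

End Converse.

End Projective.

Theorem theorem4p2 (R : realType) (Gamma : set (partial_map R))
    (Gamma_pseudogroup : pseudogroup Gamma)
    (Gamma_fixed : forall phi : partial_map R, Gamma phi ->
       ~ restriction_of_id phi -> covdim_le (fixed_points phi) 1) :
  (exists mu : R * R -> R,
     smooth (@half_plane R) mu /\ invariant_connection Gamma (nabla mu)) <->
  projective Gamma (H1_action Gamma).
Proof.
apply: iff_trans (invariant_connectionP Gamma_pseudogroup) _; split.
  by move=> [w [wC wP]]; exact: cocycle_projective wC wP.
by move=> [W [WM WC _]]; exact: projective_cocycle WM WC.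
Qed.
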